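(* Let $v\in USC(\overline{\mathbb B})$ be a viscosity subsolution of $$t^{-2}\Delta_{\mathbb B}u+t^{-2}(n-2)(t\partial_t u)+h(u)=f(t,x)\quad\text{in }\mathbb B,$$ with $\sup_{\mathbb B}v^+<+\infty$. If $t^2f\in C(\overline{\mathbb B})\cap\mathbb L^1_n(\mathbb B)$, then $$\sup_{\mathbb B}v^+\le \sup_{\partial\mathbb B}v^+ + C^*K_0d_0\,\|t^2f^-\|_{\mathbb L^1_n(\mathbb B)},$$ where $K_0,d_0,\sigma$ are the constants of condition $(G^d_{\mathbb B})$ and the constant $C^*$ depends only on $n,K_0,d_0,\sigma$.
   Context: Standing setting. $n\ge 3$; $X\subset\mathbb R^{n-1}$ is a bounded convex open set with smooth boundary; $\mathbb B=(0,1)\times X$ with points $(t,x)$; $\partial\mathbb B=(\{1\}\times X)\cup((0,1]\times\partial X)$ (the set $t=0$ is not part of the boundary), and $\overline{\mathbb B}=\mathbb B\cup\partial\mathbb B=(0,1]\times\overline X$ is the closure for the cone distance. The function $h:\mathbb R\to\mathbb R$ is continuous, non-increasing, $h(0)=0$; $f$ is continuous in $\mathbb B$. $w^+=\max\{w,0\}$, $w^-=\max\{-w,0\}$. Operators. $\nabla_{\mathbb B}=(t\partial_t,\partial_{x_1},\dots,\partial_{x_{n-1}})$, $\nabla_{\mathbb B}^2$ is the matrix of second-order derivatives formed with these vector fields, and $\Delta_{\mathbb B}u=\mathrm{tr}(\nabla^2_{\mathbb B}u)=(t\partial_t)^2u+\sum_{i=1}^{n-1}\partial_{x_i}^2u$.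 Viscosity sub/supersolution. $u\in USC(\mathbb B)$ (resp. $u\in LSC(\mathbb B)$) is a viscosity subsolution (resp. supersolution) of the equation if for every $\phi\in C^2(\mathbb B)$ and every local maximum (resp. minimum) point $(t_0,x_0)\in\mathbb B$ of $u-\phi$ one has $t_0^{-2}\Delta_{\mathbb B}\phi(t_0,x_0)+t_0^{-2}(n-2)(t\partial_t\phi)(t_0,x_0)+h(u(t_0,x_0))\ge f(t_0,x_0)$ (resp. $\le$). Norm. $\|g\|_{\mathbb L^1_n(\mathbb B)}=\left(\int_{\mathbb B}|g|^n\frac{dt}{t}dx\right)^{1/n}$, and $g\in\mathbb L^1_n(\mathbb B)$ means this is finite. Cone distance. $d_{\mathbb B}((t,x),(s,y))=|(t,x)-(s,y)|_{\mathbb B}=\sqrt{(\ln t-\ln s)^2+|x-y|^2}$ on $\mathbb R^n_+=(0,\infty)\times\mathbb R^{n-1}$; $B_{\mathbb B}((s,y),r)$ is the open ball of radius $r$ for this distance, written $B_{\mathbb B}(r)$ when the centre is not specified; $d_{\partial\mathbb B}(t,x)=\inf_{(s,y)\in\partial\mathbb B}d_{\mathbb B}((t,x),(s,y))$; $|\Omega|_{\mathbb B}=\int_\Omega\frac{dt}{t}dx$. Condition $(G^d_{\mathbb B})$, assumed with constants $K_0\ge1$, $0<\sigma<1$, $d_0>0$: for every $(t,x)\in\mathbb B$ one has $d_{\partial\mathbb B}(t,x)\le d_0$ and there is a cone ball $B_{\mathbb B}(\tilde R_{(t,x)})$ (of some centre) of radius $\tilde R_{(t,x)}\le K_0d_{\partial\mathbb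 B}(t,x)$ with $(t,x)\in B_{\mathbb B}(\tilde R_{(t,x)})$ and $|B_{\mathbb B}(\tilde R_{(t,x)})\setminus\mathbb B|_{\mathbb B}\ge\sigma|B_{\mathbb B}(\tilde R_{(t,x)})|_{\mathbb B}$. (It holds e.g. with $K_0=2$, $\sigma=1/2$, $d_0=\mathrm{diam}(X)$.) *)

(* Defs.v *)
From HB Require Import structures.
From mathcomp Require Import all_boot all_order all_algebra.
From mathcomp Require Import all_classical all_reals all_analysis.

Set Implicit Arguments.
Unset Strict Implicit.
Unset Printing Implicit Defensive.

Import Order.TTheory GRing.Theory Num.Theory.
Import numFieldNormedType.Exports.

Local Open Scope classical_set_scope.
Local Open Scope ring_scope.

(* The product sigma-algebra on row vectors, i.e. the one generated by the
   coordinate maps (as for tuples in the library). *)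
Definition rowvector_display : measure_display.
Proof. exact: default_measure_display. Qed.

Section measurable_rowvector.
Context (R : realType) (m : nat).

Let coord_fun : 'I_m -> 'rV[R]_m -> measurableTypeR R := fun i x => x ord0 i.

Let rV_set0 : g_sigma_preimage coord_fun set0.
Proof. exact: sigma_algebra0. Qed.

Let rV_setC A : g_sigma_preimage coord_fun A ->
  g_sigma_preimage coord_fun (~` A).
Proof. exact: sigma_algebraC. Qed.

Let rV_bigcup (F : (set 'rV[R]_m)^nat) :
  (forall i, g_sigma_preimage coord_fun (F i)) ->
  g_sigma_preimage coord_fun (\bigcup_i (F i)).
Proof. exact: sigma_algebra_bigcup. Qed.

HB.instance Definition _ := @isMeasurable.Build
  rowvector_display 'rV[R]_m (g_sigma_preimage coord_fun)
  rV_set0 rV_setC rV_bigcup.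

Lemma measurable_rV_coord (i : 'I_m) :
  measurable_fun [set: 'rV[R]_m]
    (fun x => x ord0 i : measurableTypeR R).
Proof.
move=> _ Y mY; rewrite setTI; apply: sub_sigma_algebra => /=.
rewrite -bigcup_seq/=; exists i => /=; first by rewrite mem_index_enum.
by exists Y => //; rewrite setTI.
Qed.

Lemma measurable_fun_rV d (T : measurableType d) (f : T -> 'rV[R]_m) :
  (forall i, measurable_fun [set: T]
     (fun t => f t ord0 i : measurableTypeR R)) ->
  measurable_fun [set: T] f.
Proof.
move=> mf _ A mA; rewrite setTI.
have : g_sigma_preimage coord_fun `<=` [set B | measurable (f @^-1` B)].
  apply: smallest_sub.
    split => /=; first by rewrite preimage_set0.
      by move=> B mB; rewrite setTD preimage_setC; exact: measurableC.
    by move=> F mF; rewrite preimage_bigcup; exact: bigcup_measurable.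
  move=> B; rewrite -bigcup_seq => -[i _ [C mC <-]] /=.
  rewrite setTI.
  by have := mf i measurableT C mC; rewrite setTI.
exact.
Qed.

End measurable_rowvector.

(* Lebesgue measure on R^m: the Dirac mass at the only point of R^0, then the
   image of the product of Lebesgue measure on R and of Lebesgue measure on R^m
   under the identification of R * R^m with R^(1 + m). *)
Section lebesgue_rowvector.
Context (R : realType).

Definition rV_cons m (p : measurableTypeR R * 'rV[R]_m) : 'rV[R]_m.+1 :=
  \row_j (if unlift ord0 j is Some i then p.2 ord0 i else p.1 : R).

Lemma rV_consE0 m p : @rV_cons m p ord0 ord0 = p.1.
Proof. by rewrite mxE unlift_none. Qed.

Lemma rV_consES m p (i : 'I_m) : @rV_cons m p ord0 (lift ord0 i) = p.2 ord0 i.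
Proof. by rewrite mxE liftK. Qed.

Lemma measurable_rV_cons m : measurable_fun setT (@rV_cons m).
Proof.
apply: measurable_fun_rV => i; case: (unliftP ord0 i) => [j|] ->.
  under eq_fun do rewrite rV_consES.
  apply: (@measurableT_comp _ _ _ _ _ _
    (fun x : 'rV[R]_m => x ord0 j : measurableTypeR R) _ snd).
    exact: measurable_rV_coord.
  exact: measurable_snd.
under eq_fun do rewrite rV_consE0.
exact: measurable_fst.
Qed.

Definition rV_uncons m (x : 'rV[R]_m.+1) : measurableTypeR R * 'rV[R]_m :=
  (x ord0 ord0, \row_j x ord0 (lift ord0 j)).

Lemma measurable_rV_uncons m : measurable_fun setT (@rV_uncons m).
Proof.
apply/measurable_fun_pairP; split; first exact: measurable_rV_coord.
apply: measurable_fun_rV => i /=.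
under eq_fun do rewrite mxE.
exact: measurable_rV_coord.
Qed.

Lemma rV_consK m : cancel (@rV_cons m) (@rV_uncons m).
Proof.
move=> [a x]; rewrite /rV_uncons rV_consE0; congr (_, _).
by apply/rowP => j; rewrite mxE rV_consES.
Qed.

Section step.
Context (m : nat) (mu : {sigma_finite_measure set 'rV[R]_m -> \bar R}).

Definition lebesgue_rV_step : set 'rV[R]_m.+1 -> \bar R :=
  pushforward (lebesgue_measure \x mu)%E (@rV_cons m).

Let step0 : lebesgue_rV_step set0 = 0%E.
Proof. by rewrite /lebesgue_rV_step /pushforward preimage_set0 measure0. Qed.

Let step_ge0 A : (0 <= lebesgue_rV_step A)%E.
Proof. by rewrite /lebesgue_rV_step /pushforward measure_ge0. Qed.

Let step_sigma_additive : semi_sigma_additive lebesgue_rV_step.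
Proof.
move=> F mF tF mUF; rewrite /lebesgue_rV_step /pushforward preimage_bigcup.
apply: measure_semi_sigma_additive.
- by move=> n; rewrite -[X in measurable X]setTI; exact: measurable_rV_cons.
- apply/trivIsetP => i j _ _ ij; rewrite -preimage_setI.
  by move/trivIsetP : tF => /(_ i j I I ij) ->; rewrite preimage_set0.
- rewrite -preimage_bigcup -[X in measurable X]setTI.
  exact: measurable_rV_cons.
Qed.

HB.instance Definition _ := isMeasure.Build _ _ _ lebesgue_rV_step
  step0 step_ge0 step_sigma_additive.

Let step_sigma_finite : sigma_finite setT lebesgue_rV_step.
Proof.
have /sigma_finiteP[F [TF ndF Foo]] :=
  sigma_finiteT (lebesgue_stieltjes_measure (@idfun R)).
have /sigma_finiteP[G [TG ndG Goo]] := sigma_finiteT mu.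
exists (fun n => @rV_uncons m @^-1` (F n `*` G n)).
  rewrite -preimage_bigcup -[LHS](@preimage_setT _ _ (@rV_uncons m)).
  congr (_ @^-1` _); rewrite -setXTT TF TG predeqE => -[x y]; split.
    move=> [/= [n _ Fnx] [k _ Gky]]; exists (maxn n k) => //; split.
    - by move: x Fnx; exact/subsetPset/ndF/leq_maxl.
    - by move: y Gky; exact/subsetPset/ndG/leq_maxr.
  by move=> [n _ []/= ? ?]; split; exists n.
move=> k; have [mF Fk] := Foo k; have [mG Gk] := Goo k; split.
  rewrite -[X in measurable X]setTI; apply: measurable_rV_uncons => //.
  exact: measurableX.
rewrite /lebesgue_rV_step /pushforward -comp_preimage.
rewrite (_ : _ \o _ = id) ?preimage_id; last first.
  by apply/funext => x; exact: rV_consK.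
by rewrite product_measure1E// lte_mul_pinfty// ge0_fin_numE.
Qed.

HB.instance Definition _ := Measure_isSigmaFinite.Build _ _ _ lebesgue_rV_step
  step_sigma_finite.

End step.

Fixpoint lebesgue_rV m : {sigma_finite_measure set 'rV[R]_m -> \bar R} :=
  match m with
  | 0 => dirac (0 : 'rV[R]_0)
  | m'.+1 => lebesgue_rV_step (lebesgue_rV m')
  end.

Lemma lebesgue_rV_box m (a b : 'rV[R]_m) :
  (forall i, a ord0 i <= b ord0 i) ->
  lebesgue_rV m [set x : 'rV[R]_m | forall i, a ord0 i <= x ord0 i <= b ord0 i] =
  (\prod_(i < m) (b ord0 i - a ord0 i))%:E.
Proof.
elim: m => [|m ih] in a b *.
  move=> _; rewrite big_ord0 /= diracE mem_set// => -[]//.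
move=> ab; rewrite big_ord_recl EFinM.
pose a' : 'rV[R]_m := \row_j a ord0 (lift ord0 j).
pose b' : 'rV[R]_m := \row_j b ord0 (lift ord0 j).
transitivity ((lebesgue_measure \x lebesgue_rV m)%E
  (([set` `[a ord0 ord0, b ord0 ord0]%R] : set (measurableTypeR R)) `*`
   [set x : 'rV[R]_m | forall i, a' ord0 i <= x ord0 i <= b' ord0 i])).
  rewrite /= /lebesgue_rV_step /pushforward; congr product_measure1.
  apply/seteqP; split => -[t x] /=.
    move=> h; split; first by have := h ord0; rewrite rV_consE0 in_itv.
    by move=> i; have := h (lift ord0 i); rewrite rV_consES !mxE.
  move=> [ht hx] i; case: (unliftP ord0 i) => [j|] ->.
    by rewrite rV_consES; have := hx j; rewrite !mxE.
  by rewrite rV_consE0; move: ht; rewrite in_itv.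
rewrite product_measure1E//; last first.
  rewrite [X in measurable X](_ : _ = \bigcap_(i in [set: 'I_m])
     ((fun x : 'rV[R]_m => x ord0 i : measurableTypeR R) @^-1`
        [set` `[a' ord0 i, b' ord0 i]])); last first.
    apply/seteqP; split => x /= h i; first by move=> _ /=; rewrite in_itv/=.
    by have := h i I; rewrite /= in_itv.
  apply: fin_bigcap_measurable => // i _.
  rewrite -[X in measurable X]setTI; apply: measurable_rV_coord => //.
congr (_ * _)%E.
  transitivity (lebesgue_measure [set` `[a ord0 ord0, b ord0 ord0]%R]) => //.
  rewrite lebesgue_measure_itv/= lte_fin.
  by case: ltgtP (ab ord0) => // -> _; rewrite subrr.
rewrite ih => [|i]; last by rewrite !mxE.
by congr EFin; apply: eq_bigr => i _; rewrite !mxE.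
Qed.

End lebesgue_rowvector.

(* C^k regularity on an open set U through iterated directional derivatives;
   the values of f outside U play no role. *)
Fixpoint Ck_on (R : realType) (V : normedModType R) (k : nat) (U : set V)
    (f : V -> R) : Prop :=
  (forall x, U x -> {for x, continuous f}) /\
  match k with
  | 0 => True
  | k'.+1 => forall v, (forall x, U x -> derivable f x v) /\
                       Ck_on k' U (fun x => 'D_v f x)
  end.

Definition boundary (T : topologicalType) (A : set T) : set T :=
  closure A `&` closure (~` A).

(* Near every boundary point X is a sublevel set {rho < 0} of a C^oo function
   with nonzero gradient at that point. *)
Definition smooth_boundary (R : realType) (m : nat) (X : set 'rV[R]_m) : Prop :=
  forall x, boundary X x ->
    exists (U : set 'rV[R]_m) (rho : 'rV[R]_m -> R),
      [/\ open U, U x, forall k, Ck_on k U rho,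
          exists v, 'D_v rho x != 0
        & forall y, U y -> (X y <-> rho y < 0)].

Definition bounded_convex_smooth_domain (R : realType) (m : nat)
    (X : set 'rV[R]_m) : Prop :=
  [/\ open X, bounded_set X,
      convex_set (X : set (convex_lmodType 'rV[R]_m)) & smooth_boundary X].

Section cone.
Context (R : realType) (n : nat).

(* Points (t, x) of R * R^(n - 1). *)
Local Notation point := (R * 'rV[R]_n.-1)%type.

Implicit Types (X : set 'rV[R]_n.-1) (p q : point) (A : set point).

Definition cone X : set point := `]0, 1[ `*` X.

(* The slice t = 0 is not part of the boundary. *)
Definition cone_boundary X : set point :=
  ([set 1] `*` X) `|` (`]0, 1] `*` boundary X).

Definition cone_closure X : set point := cone X `|` cone_boundary X.

Definition t_dt (phi : point -> R) : point -> R :=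
  fun p => p.1 * 'D_((1, 0) : point) phi p.

Definition d_x (i : 'I_n.-1) (phi : point -> R) : point -> R :=
  fun p => 'D_((0, delta_mx 0 i) : point) phi p.

Definition cone_laplacian (phi : point -> R) : point -> R :=
  fun p => t_dt (t_dt phi) p + \sum_(i < n.-1) d_x i (d_x i phi) p.

(* Upper semicontinuity of u on A for the topology induced on A; on
   t > 0 the cone distance and the Euclidean one induce the same topology. *)
Definition usc_on A (u : point -> R) : Prop :=
  lower_semicontinuous (fun p : subspace A => (- u p)%:E).

Definition viscosity_subsolution X (h : R -> R) (f u : point -> R) : Prop :=
  usc_on (cone X) u /\
  forall phi : point -> R, Ck_on 2 (cone X) phi ->
  forall p, cone X p -> (\forall q \near p, u q - phi q <= u p - phi p) ->
    p.1 ^- 2 * cone_laplacian phi p + p.1 ^- 2 * (n%:R - 2) * t_dt phi p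
      + h (u p) >= f p.

Definition lebesgue_point : set (measurableTypeR R * 'rV[R]_n.-1) -> \bar R :=
  (lebesgue_measure \x lebesgue_rV R n.-1)%E.

Definition cone_volume A : \bar R :=
  (\int[lebesgue_point]_(p in A) ((p.1 : R)^-1)%R%:E)%E.

Definition cone_Lnorm X (g : point -> R) : \bar R :=
  ((\int[lebesgue_point]_(p in cone X)
      (`|g p| ^+ n / (p.1 : R))%R%:E) `^ (n%:R^-1)%R)%E.

Definition cone_dist p q : R :=
  Num.sqrt ((ln p.1 - ln q.1) ^+ 2 + \sum_i (p.2 0 i - q.2 0 i) ^+ 2).

Definition cone_ball p (r : R) : set point :=
  [set q | 0 < q.1 /\ cone_dist q p < r].

Definition cone_boundary_dist X p : R :=
  inf [set cone_dist p q | q in cone_boundary X].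

Definition condition_G X (K0 sigma d0 : R) : Prop :=
  forall p, cone X p ->
    cone_boundary_dist X p <= d0 /\
    exists (c : point) (r : R),
      [/\ 0 < c.1, r <= K0 * cone_boundary_dist X p, cone_ball c r p
        & (sigma%:E * cone_volume (cone_ball c r) <=
           cone_volume (cone_ball c r `\` cone X))%E].

(* Membership of g in C(B) when g is only given on A: its values on B minus A
   are not used. *)
Definition continuous_up_to A (B : set point) (g : point -> R) : Prop :=
  exists g' : point -> R,
    {within B, continuous g'} /\ forall p, A p -> g' p = g p.

Definition sup_pos A (u : point -> R) : \bar R :=
  ereal_sup [set (Num.max (u p) 0)%:E | p in A].

End cone.

(* Main.v *)
(* In the variable s = ln t the equation becomes d_s^2 u + Lap_x u + (n - 2) d_s u
   + t^2 h(u) = t^2 f on the convex cylinder (-oo, 0) x X; write L for its linear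
   part.  Fix an interior point p0 = (s0, x0), let M and S be the suprema of v^+ in
   the domain and on the boundary, and g = t^2 f^-.  Since d <= d0 everywhere, X
   lies in a half-space whose boundary is at distance at most 2 d0 from x0.  A
   quadratic barrier adapted to this half-space, on a cylinder of parabolic size
   |s - s0| <= tau^2, |x - x0| <= tau with tau = tau(n, d0), reduces the estimate
   v(p0) <= S + (M - S) / 2 + C |g|_n to finding a C^2 function w >= 0 with
   L w < - g on this cylinder and w(p0) <= C |g|_n; taking suprema over p0 then
   absorbs the term (M - S) / 2.

   The function w is a finite Riemann sum over a grid centred at p0 of regularised
   fundamental solutions e^{-b (s - s_i)} (|p - p_i|^2 + delta^2)^{-b}, with
   b = (n - 2) / 2: the exponential turns the drift into a zeroth order term of
   good sign.  The value w(p0) is controlled by Young's inequality and the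
   boundedness of sum_i delta^n |p0 - p_i|^{1 - n}; contracting the grid towards p0,
   the convexity of the cylinder makes all the cells used fit inside it, so that the
   remaining Riemann sum is bounded by the integral of g^n. *)
Require Import Defs.
From mathcomp Require Import all_boot all_order all_algebra.
From mathcomp Require Import all_classical all_reals all_analysis.
From mathcomp Require Import measurable_realfun ring lra zify.
Import Order.TTheory GRing.Theory Num.Theory.
Import numFieldNormedType.Exports.
Local Open Scope classical_set_scope.
Local Open Scope ring_scope.
Set Implicit Arguments.
Unset Strict Implicit.
Unset Printing Implicit Defensive.

(** * Directional derivatives and C^k functions *)

(** Test functions must be C^2 while t^2 f is only continuous, so a Newtonian potential of g need
    not qualify; a finite sum of smooth potentials does, and comparison is then a plain
    maximum-point argument. Regularising at the mesh size delta makes a potential satisfy L <= - c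
    delta^{-n} near its own pole and L <= 0 everywhere else, so on each cell a single pole gives the
    required inequality and the others cannot spoil it. Only the value at p0 enters the conclusion;
    this is why the grid, the contraction and the barrier may all depend on p0. Localising in s is
    forced: the domain is unbounded towards t = 0, where v need not attain its supremum and t^2 f
    need not be uniformly continuous. The price is an artificial lateral boundary, on which v is
    only known to be at most M. There the barrier is at least 1, at p0 at most 1/2, and this gap is
    what allows M - S to be absorbed. *)

Section directional.
Context (R : realType) (V : normedModType R).
Implicit Types (U : set V) (f g : V -> R) (x v : V).

(** Derivability along v says nothing off the line through x, so the chain rule is reduced to the
    one-variable function h |-> f (h v + x). *)
Lemma is_derive_comp (phi : R -> R) f x v (dphi df : R) :
  is_derive (f x) 1 phi dphi -> is_derive x v f df ->
  is_derive x v (phi \o f) (dphi * df).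
Proof.
move=> hphi [fd fE].
have hg : is_derive (0 : R) 1 (fun h : R => f (h *: v + x)) df.
  split; first by have := (derivable1P f x v).1 fd.
  rewrite -fE /derive; set g1 := fun h => h^-1 *: _; set g2 := fun h => h^-1 *: _.
  suff -> : g1 = g2 by [].
  by apply/funext => h; rewrite /g1 /g2 /= addr0 scale0r add0r [_%:A]mulr1.
have hphi' : is_derive ((fun h : R => f (h *: v + x)) 0) 1 phi dphi.
  by rewrite scale0r add0r.
have [cd cE] := @is_derive1_comp R phi _ 0 _ _ hphi' hg.
split; first by apply/derivable1P.
rewrite -cE /derive; set g1 := fun h => h^-1 *: _; set g2 := fun h => h^-1 *: _.
suff -> : g1 = g2 by [].
by apply/funext => h; rewrite /g1 /g2 /= addr0 [_%:A]mulr1 scale0r add0r.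
Qed.

Lemma eq_is_derive U f g x v (df : R) : open U -> U x ->
  (forall y, U y -> f y = g y) -> is_derive x v f df -> is_derive x v g df.
Proof.
move=> oU Ux fg; apply: near_eq_is_derive.
by near=> y; apply/fg; near: y; exact: open_nbhs_nbhs.
Unshelve. all: by end_near.
Qed.

Lemma Ck_onS k U f : Ck_on k.+1 U f -> Ck_on k U f.
Proof.
elim: k f => [|k ih] f /= [fc h]; split => // v.
by have [fd hd] := h v; split => //; exact: ih.
Qed.

Lemma Ck_on_subset k U U' f : U' `<=` U -> Ck_on k U f -> Ck_on k U' f.
Proof.
move=> UU'; elim: k f => [|k ih] f /= [fc h]; split; do ?by move=> x /UU' /fc.
  by [].
by move=> v; have [fd hd] := h v; split; [move=> x /UU' /fd|exact: ih].
Qed.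

Lemma eq_Ck_on k U f g : open U -> (forall x, U x -> f x = g x) ->
  Ck_on k U f -> Ck_on k U g.
Proof.
move=> oU; elim: k f g => [|k ih] f g fg /= [fc h];
  (split; first by move=> x Ux; rewrite /prop_for /continuous_at -(fg x Ux);
     apply: cvg_trans (fc x Ux); apply: near_eq_cvg; near=> y;
     apply/fg; near: y; exact: open_nbhs_nbhs).
  by [].
move=> v; have [fd hd] := h v.
have D x : U x -> is_derive x v g ('D_v f x).
  by move=> Ux; apply: (eq_is_derive oU Ux fg); apply/derivableP/fd.
split; first by move=> x /D[].
by apply: ih hd => x /D[].
Unshelve. all: by end_near.
Qed.

Lemma Ck_on_cst k U (c : R) : Ck_on k U (cst c).
Proof.
elim: k c => [|k ih] c /=; split => //; do ?by move=> x _; exact: cst_continuous.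
move=> v; split; first by move=> x _; exact: derivable_cst.
by under eq_fun do rewrite derive_cst; exact: ih.
Qed.

Lemma Ck_onD k U f g : open U ->
  Ck_on k U f -> Ck_on k U g -> Ck_on k U (f \+ g).
Proof.
move=> oU; elim: k f g => [|k ih] f g /= [fc hf] [gc hg];
  (split; first by move=> x Ux; apply: continuousD; [exact: fc|exact: gc]) => //.
move=> v; have [fd hfd] := hf v; have [gd hgd] := hg v; split.
  by move=> x Ux; apply: derivableD; [exact: fd|exact: gd].
apply: (@eq_Ck_on k U ((fun x => 'D_v f x) \+ (fun x => 'D_v g x))) => //; last exact: ih.
by move=> x Ux; rewrite /= deriveD//; [exact: fd|exact: gd].
Qed.

Lemma Ck_onM k U f g : open U ->
  Ck_on k U f -> Ck_on k U g -> Ck_on k U (f \* g).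
Proof.
move=> oU; elim: k f g => [|k ih] f g hf hg;
  (have cfg : forall x, U x -> {for x, continuous (f \* g)}
    by move=> x Ux; apply: continuousM; [exact: hf.1|exact: hg.1]); split => //.
move=> v; have [fd hfd] := hf.2 v; have [gd hgd] := hg.2 v; split.
  by move=> x Ux; apply: derivableM; [exact: fd|exact: gd].
apply: (@eq_Ck_on k U ((f \* (fun x => 'D_v g x)) \+ (g \* (fun x => 'D_v f x)))) => //.
  by move=> x Ux; rewrite /= deriveM//; [exact: fd|exact: gd].
by apply: Ck_onD => //; apply: ih => //; exact: Ck_onS.
Qed.

Lemma Ck_on_sum k U I (r : seq I) (P : pred I) (F : I -> V -> R) : open U ->
  (forall i, P i -> Ck_on k U (F i)) -> Ck_on k U (fun x => \sum_(i <- r | P i) F i x).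
Proof.
move=> oU hF; elim: r => [|i r ih].
  by under eq_fun do rewrite big_nil; exact: Ck_on_cst.
have [Pi|/negbTE Pi] := boolP (P i); under eq_fun do rewrite big_cons Pi.
  by apply: Ck_onD => //; exact: hF.
exact: ih.
Qed.

Lemma Ck_on_expR k U f : open U -> Ck_on k U f -> Ck_on k U (expR \o f).
Proof.
move=> oU; elim: k f => [|k ih] f hf;
  (have cf : forall x, U x -> {for x, continuous (expR \o f)} by
    move=> x Ux; apply: continuous_comp; [exact: hf.1|exact: continuous_expR]);
  split => //.
move=> v; have [fd hd] := hf.2 v.
have D x : U x -> is_derive x v (expR \o f) (expR (f x) * 'D_v f x).
  by move=> Ux; apply: is_derive_comp; exact: (derivableP (fd _ Ux)).
split; first by move=> x /D[].
apply: (@eq_Ck_on k U ((expR \o f) \* (fun x => 'D_v f x))) => //.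
  by move=> x /D[].
by apply: Ck_onM => //; apply/ih/Ck_onS.
Qed.

Lemma Ck_on_ln k U f : open U -> (forall x, U x -> 0 < f x) ->
  Ck_on k U f -> Ck_on k U (fun x => ln (f x)).
Proof.
move=> oU f0; elim: k => [|k ih] hf;
  (have cf : forall x, U x -> {for x, continuous (fun y => ln (f y))} by
    move=> x Ux; apply: continuous_comp; [exact: hf.1|exact: continuous_ln (f0 _ Ux)]);
  split => //.
move=> v; have [fd hd] := hf.2 v.
have D x : U x -> is_derive x v (fun y => ln (f y)) ((f x)^-1 * 'D_v f x).
  by move=> Ux; apply: is_derive_comp;
    [exact: is_derive1_ln (f0 _ Ux)|exact: (derivableP (fd _ Ux))].
split; first by move=> x /D[].
(* 1 / f is written as exp (- ln f), so that the induction hypothesis on ln f itself covers the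
   inverse. *)
apply: (@eq_Ck_on k U ((expR \o (cst (-1) \* (fun y => ln (f y)))) \* (fun x => 'D_v f x))) => //.
  by move=> x Ux /=; rewrite mulN1r expRN lnK ?posrE ?f0//; case: (D x Ux).
apply: Ck_onM => //; apply: Ck_on_expR => //.
apply: Ck_onM => //; first exact: Ck_on_cst.
exact/ih/Ck_onS.
Qed.

End directional.

(** * The operator of the equation in the variable ln t *)

Section field_derivative.
Context (R : realType) (V : normedModType R) (U : set V).
Hypothesis oU : open U.
Implicit Types (c f g : V -> R) (v : V).

(** The vector field c D_v maps f to f' on U. The relational form keeps the existence of the
    derivative together with its value, and covers both t d_t (c = t) and d_{x_i} (c = 1). *)
Definition field_deriv c v f f' : Prop :=
  forall p, U p -> exists2 d, is_derive p v f d & c p * d = f' p.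

Lemma field_derivE c v f f' p : field_deriv c v f f' -> U p ->
  c p * 'D_v f p = f' p.
Proof. by move=> h /h[d [_ ->]]. Qed.

Lemma eq_field_deriv c v f g f' g' : (forall p, U p -> f p = g p) ->
  (forall p, U p -> f' p = g' p) -> field_deriv c v f f' -> field_deriv c v g g'.
Proof.
move=> fg fg' h p Up; have [d hd dE] := h p Up.
by exists d; [exact: eq_is_derive fg hd|rewrite -fg'].
Qed.

Lemma field_deriv2E c v f f' f'' p : field_deriv c v f f' ->
  field_deriv c v f' f'' -> U p ->
  c p * 'D_v (fun q => c q * 'D_v f q) p = f'' p.
Proof.
move=> h h'; apply: field_derivE.
by apply: eq_field_deriv h' => // q Uq; rewrite (field_derivE h).
Qed.

Lemma field_deriv_cst c v (a : R) : field_deriv c v (cst a) (cst 0).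
Proof. by move=> p _; exists 0; [exact: is_derive_cst|rewrite mulr0]. Qed.

Lemma field_derivD c v f f' g g' : field_deriv c v f f' -> field_deriv c v g g' ->
  field_deriv c v (f \+ g) (f' \+ g').
Proof.
move=> hf hg p Up; have [d hd dE] := hf p Up; have [e he eE] := hg p Up.
by exists (d + e); [exact: is_deriveD|rewrite mulrDr dE eE].
Qed.

Lemma field_derivM c v f f' g g' : field_deriv c v f f' -> field_deriv c v g g' ->
  field_deriv c v (f \* g) (fun p => f' p * g p + f p * g' p).
Proof.
move=> hf hg p Up; have [d hd <-] := hf p Up; have [e he <-] := hg p Up.
exists (f p *: e + g p *: d); first exact: is_deriveM.
by rewrite /GRing.scale/=; ring.
Qed.

Lemma field_deriv_comp c v (phi : R -> R) f f' dphi :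
  (forall p, U p -> is_derive (f p) 1 phi (dphi p)) -> field_deriv c v f f' ->
  field_deriv c v (phi \o f) (fun p => dphi p * f' p).
Proof.
move=> hphi hf p Up; have [d hd <-] := hf p Up.
exists (dphi p * d); last by rewrite mulrCA.
by apply: is_derive_comp => //; exact: hphi.
Qed.

Lemma field_deriv_sum c v I (r : seq I) (P : pred I) (F F' : I -> V -> R) :
  (forall i, field_deriv c v (F i) (F' i)) ->
  field_deriv c v (fun p => \sum_(i <- r | P i) F i p)
                  (fun p => \sum_(i <- r | P i) F' i p).
Proof.
move=> h; elim: r => [|i r ih].
  by apply: eq_field_deriv (field_deriv_cst c v 0) => p _; rewrite big_nil.
have [Pi|/negbTE Pi] := boolP (P i).
  by apply: eq_field_deriv (field_derivD (h i) ih) => p _; rewrite big_cons Pi.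
by apply: eq_field_deriv ih => p _; rewrite big_cons Pi.
Qed.

Lemma is_derive_linear f p v : (forall (h : R) q, f (h *: v + q) = h * f v + f q) ->
  is_derive p v f (f v).
Proof.
move=> lf.
have lim : h^-1 *: (f (h *: v + p) - f p) @[h --> 0^'] --> f v.
  apply: cvg_near_cst; near=> h.
  have h0 : h != 0 by near: h; exact: nbhs_dnbhs_neq.
  by rewrite /= lf addrK [_ *: _]mulKf.
split; first by apply/cvg_ex; exists (f v).
exact: cvg_lim lim.
Unshelve. all: by end_near.
Qed.

End field_derivative.

Section cone_operator.
Context (R : realType) (n : nat).
Local Notation point := (R * 'rV[R]_n.-1)%type.
Implicit Types (f g : point -> R) (p : point).

Definition half_space : set point := [set p | 0 < p.1].

Lemma open_half_space : open half_space.
Proof.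
have -> : half_space = fst @^-1` [set x : R | 0 < x] by [].
apply: open_comp; last exact: open_gt.
by move=> p _; exact: cvg_fst.
Qed.

Definition cone_operator f p : R :=
  cone_laplacian f p + (n%:R - 2) * t_dt f p.

Definition deriv_t : (point -> R) -> (point -> R) -> Prop :=
  field_deriv half_space fst (1, 0).

Definition deriv_x (i : 'I_n.-1) : (point -> R) -> (point -> R) -> Prop :=
  field_deriv half_space (cst 1) (0, delta_mx 0 i).

(** ['D_v] takes default values where a derivative fails to exist, so [cone_operator] behaves
    linearly only along with witnesses for the derivatives that it contains; the relation carries
    them. *)
Definition operator_on f Lf : Prop :=
  exists ft ftt fx fxx, [/\ deriv_t f ft, deriv_t ft ftt,
    forall i, deriv_x i f (fx i), forall i, deriv_x i (fx i) (fxx i) &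
    forall p, half_space p ->
      ftt p + \sum_i fxx i p + (n%:R - 2) * ft p = Lf p].

Lemma operator_onE f Lf p : operator_on f Lf -> half_space p ->
  cone_operator f p = Lf p.
Proof.
move=> [ft [ftt [fx [fxx [h1 h2 h3 h4 h5]]]]] Up.
rewrite -h5// /cone_operator /cone_laplacian /t_dt (field_derivE h1 Up).
rewrite (field_deriv2E open_half_space h1 h2 Up); congr (_ + _ + _).
apply: eq_bigr => i _; rewrite /d_x -(field_deriv2E open_half_space (h3 i) (h4 i) Up).
by rewrite mul1r; under [in RHS]eq_fun do rewrite mul1r.
Qed.

Lemma operator_onD f Lf g Lg : operator_on f Lf -> operator_on g Lg ->
  operator_on (f \+ g) (Lf \+ Lg).
Proof.
move=> [ft [ftt [fx [fxx [h1 h2 h3 h4 h5]]]]] [gt [gtt [gx [gxx [k1 k2 k3 k4 k5]]]]].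
exists (ft \+ gt), (ftt \+ gtt), (fun i => fx i \+ gx i), (fun i => fxx i \+ gxx i).
split; [exact: field_derivD h1 k1|exact: field_derivD h2 k2|
  by move=> i; exact: field_derivD (h3 i) (k3 i)|
  by move=> i; exact: field_derivD (h4 i) (k4 i)|].
by move=> p Up; rewrite /= -(h5 p Up) -(k5 p Up) big_split/=; ring.
Qed.

Lemma operator_onZ (a : R) f Lf : operator_on f Lf ->
  operator_on (cst a \* f) (cst a \* Lf).
Proof.
have Z c v g g' : field_deriv half_space c v g g' ->
    field_deriv half_space c v (cst a \* g) (cst a \* g').
  move=> h; have := field_derivM (@field_deriv_cst _ _ half_space c v a) h.
  by apply: eq_field_deriv; [exact: open_half_space|by []|move=> p _ /=; rewrite mul0r add0r].
move=> [ft [ftt [fx [fxx [h1 h2 h3 h4 h5]]]]].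
exists (cst a \* ft), (cst a \* ftt), (fun i => cst a \* fx i), (fun i => cst a \* fxx i).
split; [exact: Z h1|exact: Z h2|by move=> i; exact: Z (h3 i)|by move=> i; exact: Z (h4 i)|].
by move=> p Up; rewrite /= -(h5 p Up) -mulr_sumr; ring.
Qed.

Lemma operator_on_cst (a : R) : operator_on (cst a) (cst 0).
Proof.
exists (cst 0), (cst 0), (fun=> cst 0), (fun=> cst 0); split;
  [exact: field_deriv_cst|exact: field_deriv_cst|
  by move=> i; exact: field_deriv_cst|by move=> i; exact: field_deriv_cst|].
by move=> p _ /=; rewrite big1// mulr0 !addr0.
Qed.

Lemma eq_operator_on f Lf g Lg :
  (forall p, half_space p -> f p = g p) -> (forall p, half_space p -> Lf p = Lg p) ->
  operator_on f Lf -> operator_on g Lg.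
Proof.
move=> fg Lfg [ft [ftt [fx [fxx [h1 h2 h3 h4 h5]]]]].
exists ft, ftt, fx, fxx; split => //.
- by apply: eq_field_deriv h1 => //; exact: open_half_space.
- by move=> i; apply: eq_field_deriv (h3 i) => //; exact: open_half_space.
- by move=> p Up; rewrite h5// Lfg.
Qed.

Lemma operator_on_sum I (r : seq I) (F LF : I -> point -> R) :
  (forall i, operator_on (F i) (LF i)) ->
  operator_on (fun p => \sum_(i <- r) F i p) (fun p => \sum_(i <- r) LF i p).
Proof.
move=> h; elim: r => [|i r ih].
  by apply: eq_operator_on (operator_on_cst 0) => p _; rewrite big_nil.
by apply: eq_operator_on (operator_onD (h i) ih) => p _; rewrite big_cons.
Qed.

Lemma deriv_t_ln : deriv_t (fun p => ln p.1) (cst 1).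
Proof.
move=> p Up; exists (p.1^-1 * 1); last by rewrite mulr1 /= divff// gt_eqF.
apply: is_derive_comp; first exact: is_derive1_ln Up.
have := @is_derive_linear R point fst p (1, 0).
by apply => h q; rewrite /= [_%:A]mulr1 mulr1.
Qed.

Lemma deriv_x_ln i : deriv_x i (fun p => ln p.1) (cst 0).
Proof.
move=> p Up; exists (p.1^-1 * 0); last by rewrite mulr0 mulr0.
apply: is_derive_comp; first exact: is_derive1_ln Up.
have := @is_derive_linear R point fst p (0, delta_mx 0 i).
by apply => h q; rewrite /= scaler0 mulr0.
Qed.

Lemma deriv_t_coord j : deriv_t (fun p => p.2 0 j) (cst 0).
Proof.
move=> p Up; exists 0; last by rewrite mulr0.
have -> : 0 = ((1, 0) : point).2 0 j by rewrite mxE.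
by apply: (@is_derive_linear _ _ (fun p : point => p.2 0 j)) => h q; rewrite /= !mxE.
Qed.

Lemma deriv_x_coord i j : deriv_x i (fun p => p.2 0 j) (cst (i == j)%:R).
Proof.
move=> p Up; exists (i == j)%:R; last by rewrite mul1r.
have -> : (i == j)%:R = ((0, delta_mx 0 i) : point).2 0 j.
  by rewrite mxE eqxx eq_sym.
by apply: (@is_derive_linear _ _ (fun p : point => p.2 0 j)) => h q; rewrite /= !mxE.
Qed.

Lemma Ck_on_ln1 k : Ck_on k half_space (fun p => ln p.1).
Proof.
apply: Ck_on_ln => //; first exact: open_half_space.
case: k => [|k]; (split; first by move=> p _; exact: cvg_fst) => //.
have D v p : is_derive p v (fst : point -> R) v.1.
  by apply: (@is_derive_linear _ _ fst).
move=> v; split; first by move=> p _; case: (D v p).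
apply: eq_Ck_on (Ck_on_cst k half_space v.1); first exact: open_half_space.
by move=> p _; case: (D v p).
Qed.

Lemma continuous_coord j : continuous (fun p : point => p.2 0 j).
Proof.
move=> p; apply: (@continuous_comp _ _ _ snd (fun x : 'rV[R]_n.-1 => x 0 j)).
  exact: cvg_snd.
exact: coord_continuous.
Qed.

Lemma Ck_on_coord k j : Ck_on k half_space (fun p => p.2 0 j).
Proof.
case: k => [|k]; (split; first by move=> p _; exact: continuous_coord) => //.
have D v p : is_derive p v (fun p : point => p.2 0 j) (v.2 0 j).
  apply: (@is_derive_linear _ _ (fun p : point => p.2 0 j)) => h q.
  by rewrite /= !mxE.
move=> v; split; first by move=> p _; case: (D v p).
apply: eq_Ck_on (Ck_on_cst k half_space (v.2 0 j)); first exact: open_half_space.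
by move=> p _; case: (D v p).
Qed.

End cone_operator.

(** * Regularised fundamental solutions *)

Section cone_functions.
Context (R : realType) (n : nat).
Hypothesis n_gt0 : (0 < n)%N.
Local Notation point := (R * 'rV[R]_n.-1)%type.
Local Notation U := (@half_space R n).
Local Notation oU := (@open_half_space R n).
Implicit Types (p : point) (s : R) (y e : 'rV[R]_n.-1).

Let pred_natr : (n.-1)%:R = n%:R - 1 :> R.
Proof. by rewrite -[in RHS](prednK n_gt0) -natr1 addrK. Qed.

Definition tdiff s p : R := ln p.1 - s.
Definition xdiff y i p : R := p.2 0 i - y 0 i.
Definition xsqdist y p : R := \sum_i xdiff y i p ^+ 2.
Definition level y e p : R := \sum_i e 0 i * (y 0 i - p.2 0 i).

Lemma deriv_t_tdiff s : deriv_t (tdiff s) (cst 1).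
Proof.
apply: eq_field_deriv (field_derivD (@deriv_t_ln R n) (field_deriv_cst _ _ (- s))).
- exact: oU.
- by [].
- by move=> p _ /=; rewrite addr0.
Qed.

Lemma deriv_x_tdiff i s : deriv_x i (tdiff s) (cst 0).
Proof.
apply: eq_field_deriv (field_derivD (@deriv_x_ln R n i) (field_deriv_cst _ _ (- s))).
- exact: oU.
- by [].
- by move=> p _ /=; rewrite addr0.
Qed.

Lemma deriv_t_xdiff y j : deriv_t (xdiff y j) (cst 0).
Proof.
apply: eq_field_deriv (field_derivD (@deriv_t_coord R n j) (field_deriv_cst _ _ (- y 0 j))).
- exact: oU.
- by [].
- by move=> p _ /=; rewrite addr0.
Qed.

Lemma deriv_x_xdiff y i j : deriv_x i (xdiff y j) (cst (i == j)%:R).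
Proof.
apply: eq_field_deriv (field_derivD (@deriv_x_coord R n i j) (field_deriv_cst _ _ (- y 0 j))).
- exact: oU.
- by [].
- by move=> p _ /=; rewrite addr0.
Qed.

Lemma field_derivX2 c v (f f' : point -> R) : field_deriv U c v f f' ->
  field_deriv U c v (fun p => f p ^+ 2) (fun p => 2 * f p * f' p).
Proof.
move=> h; apply: eq_field_deriv (field_derivM h h); first exact: oU.
  by move=> p _.
by move=> p _; ring.
Qed.

Lemma field_derivZ c v (a : R) (f f' : point -> R) : field_deriv U c v f f' ->
  field_deriv U c v (fun p => a * f p) (fun p => a * f' p).
Proof.
move=> h; apply: eq_field_deriv (field_derivM (field_deriv_cst _ _ a) h); first exact: oU.
  by move=> p _.
by move=> p _; rewrite mul0r add0r.
Qed.

Lemma deriv_t_xsqdist y : deriv_t (xsqdist y) (cst 0).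
Proof.
apply: eq_field_deriv (field_deriv_sum oU _ _
  (fun i => field_derivX2 (@deriv_t_xdiff y i))); first exact: oU.
  by [].
by move=> p _ /=; rewrite big1// => i _; rewrite mulr0.
Qed.

Lemma deriv_x_xsqdist y i : deriv_x i (xsqdist y) (fun p => 2 * xdiff y i p).
Proof.
apply: eq_field_deriv (field_deriv_sum oU _ _
  (fun j => field_derivX2 (@deriv_x_xdiff y i j))); first exact: oU.
  by [].
move=> p _ /=; rewrite (bigD1 i)//= eqxx mulr1 big1 ?addr0// => j /negbTE ji.
by rewrite eq_sym ji mulr0.
Qed.

Lemma deriv_t_level y e : deriv_t (level y e) (cst 0).
Proof.
apply: eq_field_deriv (field_deriv_sum oU (index_enum _) xpredT
  (fun i => field_derivZ (- e 0 i) (@deriv_t_xdiff y i))); first exact: oU.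
  by move=> p _; apply: eq_bigr => i _; rewrite /xdiff; ring.
by move=> p _ /=; rewrite big1// => i _; rewrite mulr0.
Qed.

Lemma deriv_x_level y e i : deriv_x i (level y e) (cst (- e 0 i)).
Proof.
apply: eq_field_deriv (field_deriv_sum oU (index_enum _) xpredT
  (fun j => field_derivZ (- e 0 j) (@deriv_x_xdiff y i j))); first exact: oU.
  by move=> p _; apply: eq_bigr => j _; rewrite /xdiff; ring.
move=> p _ /=; rewrite (bigD1 i)//= eqxx mulr1 big1 ?addr0// => j /negbTE ji.
by rewrite eq_sym ji mulr0.
Qed.

Lemma operator_on_tdiff2 s : operator_on (fun p => tdiff s p ^+ 2)
  (fun p => 2 + 2 * (n%:R - 2) * tdiff s p).
Proof.
exists (fun p => 2 * tdiff s p * 1), (fun=> 2), (fun i p => 2 * tdiff s p * 0), (fun i p => 0).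
split.
- exact: field_derivX2 (deriv_t_tdiff s).
- apply: eq_field_deriv (field_derivZ 2 (deriv_t_tdiff s)); first exact: oU.
    by move=> p _; rewrite mulr1.
  by move=> p _ /=; rewrite mulr1.
- by move=> i; exact: field_derivX2 (deriv_x_tdiff i s).
- move=> i; apply: eq_field_deriv (field_deriv_cst _ _ 0); first exact: oU.
    by move=> p _; rewrite mulr0.
  by [].
- by move=> p _; rewrite big1//; ring.
Qed.

Lemma operator_on_xsqdist y : operator_on (xsqdist y) (cst (2 * (n%:R - 1))).
Proof.
exists (cst 0), (cst 0), (fun i p => 2 * xdiff y i p), (fun i p => 2 * 1).
split.
- exact: deriv_t_xsqdist.
- exact: field_deriv_cst.
- by move=> i; exact: deriv_x_xsqdist.
- move=> i; apply: eq_field_deriv (field_derivZ 2 (deriv_x_xdiff y i i)); first exact: oU.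
    by [].
  by move=> p _; rewrite /= eqxx.
- by move=> p _ /=; rewrite sumr_const card_ord -[_ *+ n.-1]mulr_natr pred_natr; ring.
Qed.

Lemma operator_on_level y e : operator_on (level y e) (cst 0).
Proof.
exists (cst 0), (cst 0), (fun i => cst (- e 0 i)), (fun i => cst 0).
split; [exact: deriv_t_level|exact: field_deriv_cst|by move=> i; exact: deriv_x_level|
  by move=> i; exact: field_deriv_cst|].
by move=> p _ /=; rewrite big1// mulr0 !addr0.
Qed.

Lemma operator_on_level2 y e : operator_on (fun p => level y e p ^+ 2)
  (cst (2 * \sum_i e 0 i ^+ 2)).
Proof.
exists (cst 0), (cst 0), (fun i p => 2 * level y e p * - e 0 i),
  (fun i => cst (2 * e 0 i ^+ 2)).
split.
- apply: eq_field_deriv (field_derivX2 (deriv_t_level y e)); first exact: oU.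
    by [].
  by move=> p _ /=; rewrite mulr0.
- exact: field_deriv_cst.
- by move=> i; exact: field_derivX2 (deriv_x_level y e i).
- move=> i; apply: eq_field_deriv (field_derivZ (- 2 * e 0 i) (deriv_x_level y e i)).
  + exact: oU.
  + by move=> p _; ring.
  + by move=> p _ /=; ring.
- by move=> p _ /=; rewrite -mulr_sumr; ring.
Qed.

Lemma field_deriv_exp c v (f f' : point -> R) : field_deriv U c v f f' ->
  field_deriv U c v (fun p => expR (f p)) (fun p => expR (f p) * f' p).
Proof. by move=> h; apply: field_deriv_comp h => p _; exact: is_derive_expR. Qed.

Lemma field_deriv_exp2 c v (f f' f'' : point -> R) : field_deriv U c v f f' ->
  field_deriv U c v f' f'' ->
  field_deriv U c v (fun p => expR (f p) * f' p)
    (fun p => expR (f p) * (f' p ^+ 2 + f'' p)).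
Proof.
move=> h h'; apply: eq_field_deriv (field_derivM (field_deriv_exp h) h'); first exact: oU.
  by [].
by move=> p _; ring.
Qed.

Lemma operator_on_exp (f ft ftt : point -> R) (fx fxx : 'I_n.-1 -> point -> R) :
  deriv_t f ft -> deriv_t ft ftt ->
  (forall i, deriv_x i f (fx i)) -> (forall i, deriv_x i (fx i) (fxx i)) ->
  operator_on (fun p => expR (f p)) (fun p => expR (f p) *
    (ft p ^+ 2 + ftt p + \sum_i (fx i p ^+ 2 + fxx i p) + (n%:R - 2) * ft p)).
Proof.
move=> h1 h2 h3 h4.
exists (fun p => expR (f p) * ft p), (fun p => expR (f p) * (ft p ^+ 2 + ftt p)),
  (fun i p => expR (f p) * fx i p), (fun i p => expR (f p) * (fx i p ^+ 2 + fxx i p)).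
split; [exact: field_deriv_exp|exact: field_deriv_exp2|
  by move=> i; exact: field_deriv_exp (h3 i)|
  by move=> i; exact: field_deriv_exp2 (h3 i) (h4 i)|].
by move=> p _; rewrite -mulr_sumr; ring.
Qed.

Section potential.
Context (s : R) (y : 'rV[R]_n.-1) (delta : R).
Hypothesis delta_gt0 : 0 < delta.

Definition rho p : R := tdiff s p ^+ 2 + xsqdist y p + delta ^+ 2.

Let b : R := (n%:R - 2) / 2.

(** This is e^{- b tdiff} rho^{- b}; the real power is written through exp and ln so that
    [operator_on_exp] and [Ck_on_expR] apply directly. *)
Definition potential p : R := expR (- b * tdiff s p + - b * ln (rho p)).

Lemma xsqdist_ge0 p : 0 <= xsqdist y p.
Proof. by apply: sumr_ge0 => i _; exact: sqr_ge0. Qed.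

Lemma rho_gt0 p : 0 < rho p.
Proof.
by rewrite ltr_wpDl ?exprn_gt0// addr_ge0 ?sqr_ge0 ?xsqdist_ge0.
Qed.

Lemma deriv_t_rho : deriv_t rho (fun p => 2 * tdiff s p).
Proof.
apply: eq_field_deriv (field_derivD (field_derivD (field_derivX2 (deriv_t_tdiff s))
  (deriv_t_xsqdist y)) (field_deriv_cst _ _ (delta ^+ 2))); first exact: oU.
  by [].
by move=> p _ /=; rewrite mulr1 !addr0.
Qed.

Lemma deriv_x_rho i : deriv_x i rho (fun p => 2 * xdiff y i p).
Proof.
apply: eq_field_deriv (field_derivD (field_derivD (field_derivX2 (deriv_x_tdiff i s))
  (deriv_x_xsqdist y i)) (field_deriv_cst _ _ (delta ^+ 2))); first exact: oU.
  by [].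
by move=> p _ /=; rewrite mulr0 addr0 add0r.
Qed.

Lemma field_deriv_ln_rho c v r' : field_deriv U c v rho r' ->
  field_deriv U c v (fun p => ln (rho p)) (fun p => r' p / rho p).
Proof.
move=> h; apply: eq_field_deriv (@field_deriv_comp _ _ _ _ _ (@ln R) _ _
  (fun p => (rho p)^-1) _ h); [exact: oU|by []| |].
  by move=> p _; rewrite mulrC.
by move=> p _; apply: is_derive1_ln; exact: rho_gt0.
Qed.

Lemma field_deriv_div_rho c v r' f f' : field_deriv U c v rho r' ->
  field_deriv U c v f f' ->
  field_deriv U c v (fun p => f p / rho p)
    (fun p => f' p / rho p - f p * r' p / rho p ^+ 2).
Proof.
move=> h hf; have inv : field_deriv U c v (fun p => (rho p)^-1)
    (fun p => - (rho p) ^- 2 * r' p).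
  apply: (@field_deriv_comp _ _ _ _ _ (@GRing.inv R) _ _
    (fun p => - (rho p) ^- 2) _ h) => p _.
  have r0 : rho p != 0 by rewrite gt_eqF ?rho_gt0.
  have -> : - (rho p) ^- 2 = - (rho p) ^- 2 *: (1 : R) by rewrite [RHS]mulr1.
  exact: is_deriveV.
apply: eq_field_deriv (field_derivM hf inv); first exact: oU.
  by [].
by move=> p _ /=; ring.
Qed.

(** As the drift coefficient is n - 2 = 2 b, the factor e^{- b tdiff} removes the first-order term
    and leaves - b^2. As 2 b + 2 = n, the terms in rho^{- b - 1} of the Laplacian of rho^{- b}
    cancel, and only - 2 b n delta^2 rho^{- b - 2} remains. *)
Lemma operator_on_potential : operator_on potential
  (fun p => - (potential p * (b ^+ 2 + 2 * b * n%:R * delta ^+ 2 / rho p ^+ 2))).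
Proof.
have A1 := field_derivD (field_derivZ (- b) (deriv_t_tdiff s))
  (field_derivZ (- b) (field_deriv_ln_rho deriv_t_rho)).
have A2 := field_derivD (field_deriv_cst _ _ (- b * 1)) (field_derivZ (- b)
  (field_deriv_div_rho deriv_t_rho (field_derivZ 2 (deriv_t_tdiff s)))).
have A3 i := field_derivD (field_derivZ (- b) (deriv_x_tdiff i s))
  (field_derivZ (- b) (field_deriv_ln_rho (deriv_x_rho i))).
have A4 i := field_derivD (field_deriv_cst _ _ (- b * 0)) (field_derivZ (- b)
  (field_deriv_div_rho (deriv_x_rho i) (field_derivZ 2 (deriv_x_xdiff y i i)))).
apply: eq_operator_on (operator_on_exp A1 A2 A3 A4) => // p _ /=.
rewrite -[RHS]mulrN; congr (_ * _).
have -> : \sum_i ((- b * 0 + - b * (2 * xdiff y i p / rho p)) ^+ 2 +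
      (0 + - b * (2 * (i == i)%:R / rho p -
                  2 * xdiff y i p * (2 * xdiff y i p) / rho p ^+ 2))) =
    (4 * b ^+ 2 + 4 * b) / rho p ^+ 2 * xsqdist y p - 2 * b * (n%:R - 1) / rho p.
  under eq_bigr => i _.
    have -> : (- b * 0 + - b * (2 * xdiff y i p / rho p)) ^+ 2 +
      (0 + - b * (2 * (i == i)%:R / rho p -
                  2 * xdiff y i p * (2 * xdiff y i p) / rho p ^+ 2)) =
      (4 * b ^+ 2 + 4 * b) / rho p ^+ 2 * xdiff y i p ^+ 2 - 2 * b / rho p.
      rewrite eqxx mulr1n; field; by rewrite gt_eqF ?rho_gt0.
    over.
  by rewrite sumrB -mulr_sumr -/(xsqdist y p) sumr_const card_ord
    -[_ *+ n.-1]mulr_natr pred_natr; ring.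
have -> : xsqdist y p = rho p - tdiff s p ^+ 2 - delta ^+ 2 by rewrite /rho; ring.
rewrite /b; field; by rewrite gt_eqF ?rho_gt0.
Qed.

Lemma Ck_on_tdiff k : Ck_on k U (tdiff s).
Proof. by apply: Ck_onD; [exact: oU|exact: Ck_on_ln1|exact: Ck_on_cst]. Qed.

Lemma Ck_on_xsqdist k : Ck_on k U (xsqdist y).
Proof.
apply: Ck_on_sum; first exact: oU.
move=> i _; have h : Ck_on k U (xdiff y i).
  by apply: Ck_onD; [exact: oU|exact: Ck_on_coord|exact: Ck_on_cst].
apply: eq_Ck_on (Ck_onM oU h h); first exact: oU.
by move=> p _.
Qed.

Lemma Ck_on_level e k : Ck_on k U (level y e).
Proof.
apply: Ck_on_sum; first exact: oU.
move=> i _; apply: (@Ck_onM _ _ k U (cst (e 0 i)) (fun p => y 0 i - p.2 0 i)).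
- exact: oU.
- exact: Ck_on_cst.
- apply: (@eq_Ck_on _ _ k U (cst (y 0 i) \+ (cst (-1) \* (fun p => p.2 0 i)))).
  + exact: oU.
  + by move=> p _ /=; rewrite mulN1r.
  + apply: Ck_onD; [exact: oU|exact: Ck_on_cst|].
    by apply: Ck_onM; [exact: oU|exact: Ck_on_cst|exact: Ck_on_coord].
Qed.

Lemma Ck_on_potential k : Ck_on k U potential.
Proof.
apply: (@Ck_on_expR _ _ k U); first exact: oU.
apply: Ck_onD; first exact: oU.
  apply: Ck_onM; [exact: oU|exact: Ck_on_cst|exact: Ck_on_tdiff].
apply: Ck_onM; [exact: oU|exact: Ck_on_cst|].
apply: Ck_on_ln; first exact: oU.
  by move=> p _; exact: rho_gt0.
apply: Ck_onD; [exact: oU| |exact: Ck_on_cst].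
apply: Ck_onD; [exact: oU| |exact: Ck_on_xsqdist].
apply: eq_Ck_on (Ck_onM oU (Ck_on_tdiff k) (Ck_on_tdiff k)); first exact: oU.
by move=> p _.
Qed.

End potential.
End cone_functions.

(** * A sum over a grid *)

Section grid_sum.
Context (R : realType) (N : nat) (J : finType).
Local Notation M := (N.*2.+1).

Definition offset (k : 'I_M) : R := k%:R - N%:R.

Lemma norm_offset_le (k : 'I_M) : `|offset k| <= N%:R.
Proof.
have kM : (k%:R : R) <= N%:R + N%:R.
  by rewrite -natrD addnn ler_nat -ltnS ltn_ord.
have k0 := ler0n R k.
by rewrite /offset ler_norml; apply/andP; split; lra.
Qed.

(** With r = |offset a|, the indices counted embed into the 2 r + 1 integers from N - r to N + r. *)
Lemma sum_offset_le (a : 'I_M) :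
  \sum_(k : 'I_M) (`|offset k| <= `|offset a|)%R%:R <= 2 * `|offset a| + 1.
Proof.
pose r := maxn (a - N) (N - a).
have ra : `|offset a| = r%:R.
  rewrite /offset /r; case: (leqP N a) => Na.
    by rewrite -natrB// normr_nat; congr (_%:R); lia.
  by rewrite -normrN opprB -natrB ?(ltnW Na)// normr_nat; congr (_%:R); lia.
have -> : \sum_(k : 'I_M) (`|offset k| <= `|offset a|)%R%:R =
    (\sum_(k : 'I_M | `|offset k| <= `|offset a|) 1)%:R :> R.
  by rewrite natr_sum [RHS]big_mkcond/=; apply: eq_bigr => k _; case: ifP.
rewrite ra -natrM natr1 ler_nat sum1_card cardE -(size_map val) -(addn1 (2 * r)).
rewrite -(size_iota (N - r) (2 * r + 1)).
apply: uniq_leq_size; first by rewrite map_inj_uniq ?enum_uniq//; exact: val_inj.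
move=> _ /mapP[k + ->]; rewrite mem_enum unfold_in mem_iota.
change (`|offset k| <= r%:R :> R -> (N - r <= k < N - r + (2 * r + 1))%N).
rewrite /offset ler_norml.
move=> /andP[]; rewrite lerBrDr lerBlDr -natrD ler_nat.
move=> h1 h2.
have : (N <= k + r)%N by rewrite -(ler_nat R) natrD; lra.
by rewrite /=; lia.
Qed.

(** Grid points are sorted by a coordinate j of largest absolute offset and by its index a: there
    are d + 1 choices of j, 2 N + 1 of a, and at most (2 |offset a| + 1)^d points in each class,
    against a weight C / (1 + |offset a|)^d. Thus sums of |q|^{-d} in dimension d + 1 grow only
    linearly in N. *)
Lemma sum_max_norm_pow_le (d : nat) (C : R) (F : {ffun J -> 'I_M} -> R) :
  #|J| = d.+1 -> 0 <= C ->
  (forall q j, F q * (1 + `|offset (q j)|) ^+ d <= C) ->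
  \sum_q F q <= d.+1%:R * M%:R * 2 ^+ d * C.
Proof.
move=> cJ C0 hF.
pose c (a : 'I_M) : R := C / (1 + `|offset a|) ^+ d.
have c0 a : 0 <= c a by rewrite divr_ge0// exprn_ge0// addr_ge0.
(* Indicator, in coordinate i, of the class of (j, a). Its product over i lets the sum over q factor
   into sums over single coordinates. *)
pose G (j : J) (a : 'I_M) (i : J) (k : 'I_M) : R :=
  if i == j then (k == a)%:R else (`|offset k| <= `|offset a|)%R%:R.
have G0 j a i k : 0 <= G j a i k by rewrite /G; case: ifP.
apply: (@le_trans _ _ (\sum_(q : {ffun J -> 'I_M}) \sum_j \sum_a c a * \prod_i G j a i (q i))).
  apply: ler_sum => q _.
  have [j0 _] : {j | j \in J} by apply/sigW/card_gt0P; rewrite cJ.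
  pose j := [arg max_(j > j0) `|offset (q j)|]%O.
  have hj i : `|offset (q i)| <= `|offset (q j)|.
    by rewrite /j; case: Order.TotalTheory.arg_maxP => // k _; exact.
  have T0 j' a : 0 <= c a * \prod_i G j' a i (q i) by rewrite mulr_ge0// prodr_ge0.
  rewrite (bigD1 j)//= (bigD1 (q j))//= -addrA.
  have -> : \prod_i G j (q j) i (q i) = 1.
    by apply: big1 => i _; rewrite /G; case: eqP => [->|_]; rewrite ?eqxx ?hj.
  rewrite mulr1 ler_wpDr//; last by rewrite ler_pdivlMr ?exprn_gt0 ?ltr_pwDl.
  by rewrite addr_ge0// sumr_ge0// => ? _; rewrite sumr_ge0.
rewrite exchange_big/= -[_%:R * _ * _ * _]mulrA -[_ * (_ * C)]mulrA.
rewrite mulr_natl -cJ -sumr_const; apply: ler_sum => j _.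
rewrite exchange_big/= mulr_natl -[in leRHS](card_ord M) -sumr_const.
apply: ler_sum => a _; rewrite -mulr_sumr.
rewrite -(bigA_distr_bigA (fun i k => G j a i k)) (bigD1 j)//=.
have -> : \sum_k G j a j k = 1.
  rewrite (bigD1 a)//= /G !eqxx big1 ?addr0// => k /negbTE ka.
  by rewrite ka.
rewrite mul1r mulrC.
apply: (@le_trans _ _ ((2 * (1 + `|offset a|)) ^+ d * c a)).
  rewrite ler_wpM2r//.
  have -> : d = #|[pred i | i != j]|.
    by have := cardC1 j; rewrite cJ /= => <-; apply: eq_card.
  rewrite -prodr_const; apply: ler_prod => i ij.
  rewrite sumr_ge0//=.
  under eq_bigr do rewrite /G (negbTE ij).
  by apply: le_trans (sum_offset_le a) _; lra.
rewrite exprMn /c -mulrA; set u := (1 + _) ^+ d.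
by rewrite [u * _]mulrCA divff ?mulr1// expf_neq0// gt_eqF// ltr_pwDl.
Qed.

End grid_sum.

(** * Lower bounds for integrals by disjoint boxes *)

(** The integral of a nonnegative function is the supremum over the nonnegative simple functions
    below it, hence is monotone for arbitrary functions, such as the integrand |g|^n / t below. *)
Lemma ge0_le_integralT d (T : measurableType d) (R : realType)
    (mu : {measure set T -> \bar R}) (f g : T -> \bar R) :
  (forall x, (0 <= f x)%E) -> (forall x, (f x <= g x)%E) ->
  (\int[mu]_x f x <= \int[mu]_x g x)%E.
Proof.
move=> f0 fg; have g0 x : (0 <= g x)%E by exact: le_trans (f0 x) (fg x).
rewrite !ge0_integralTE//; apply: le_ereal_sup => _ [h hf <-].
by exists h => // x; exact: le_trans (hf x) (fg x).
Qed.

Section boxes.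
Context (R : realType) (n : nat).
Local Notation point := (R * 'rV[R]_n.-1)%type.

Definition log_box (s : R) (y : 'rV[R]_n.-1) (h : R) :
    set (measurableTypeR R * 'rV[R]_n.-1) :=
  [set` `[expR (s - h), expR (s + h)]%R] `*`
  [set x : 'rV[R]_n.-1 | forall i, y 0 i - h <= x 0 i <= y 0 i + h].

Lemma measurable_rV_box m (a b : 'rV[R]_m) :
  measurable [set x : 'rV[R]_m | forall i, a 0 i <= x 0 i <= b 0 i].
Proof.
rewrite [X in measurable X](_ : _ = \bigcap_(i in [set: 'I_m])
   ((fun x : 'rV[R]_m => x ord0 i : measurableTypeR R) @^-1`
      [set` `[a ord0 i, b ord0 i]])); last first.
  apply/seteqP; split => x /= h i; first by move=> _ /=; rewrite in_itv/=.
  by have := h i I; rewrite /= in_itv.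
apply: fin_bigcap_measurable => // i _.
by rewrite -[X in measurable X]setTI; apply: measurable_rV_coord.
Qed.

Let rV_boxE (y : 'rV[R]_n.-1) (h : R) :
  [set x : 'rV[R]_n.-1 | forall i, y 0 i - h <= x 0 i <= y 0 i + h] =
  [set x | forall i, (\row_j (y 0 j - h)) 0 i <= x 0 i <= (\row_j (y 0 j + h)) 0 i].
Proof. by apply/seteqP; split => x /= hx i; have := hx i; rewrite !mxE. Qed.

Lemma measurable_log_box s y h : measurable (log_box s y h).
Proof.
apply: measurableX; first exact: measurable_itv.
by rewrite rV_boxE; exact: measurable_rV_box.
Qed.

Lemma lebesgue_log_box s y h : 0 <= h ->
  @lebesgue_point R n (log_box s y h) =
  ((expR (s + h) - expR (s - h)) * (2 * h) ^+ n.-1)%:E.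
Proof.
move=> h0; rewrite /lebesgue_point product_measure1E//; last first.
  by rewrite rV_boxE; exact: measurable_rV_box.
rewrite EFinM; congr (_ * _)%E.
  transitivity (lebesgue_measure [set` `[expR (s - h), expR (s + h)]%R]) => //.
  rewrite lebesgue_measure_itv/= lte_fin ltr_expR.
  move: h0; rewrite le_eqVlt => /predU1P[<-|h1]; first by rewrite subr0 addr0 ltxx subrr.
  by rewrite ifT// ltrD2l gt0_cp.
rewrite rV_boxE lebesgue_rV_box => [|i]; last by rewrite !mxE lerD2l ge0_cp.
rewrite -[X in _ ^+ X]card_ord -prodr_const; congr EFin.
by apply: eq_bigr => i _; rewrite !mxE; ring.
Qed.

(** The integrand dominates the simple function with value b_i^n e^{-(s_i + h)} on box i, since 1 /
    t is at least e^{-(s_i + h)} there. The logarithmic length 2 h of a box is only kept up to a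
    factor 2, hence the leading h. *)
Lemma integral_ge_sum_boxes (X : set 'rV[R]_n.-1) (g : point -> R)
    (I : finType) (P : pred I) (s b : I -> R) (y : I -> 'rV[R]_n.-1) (h : R) :
  0 < h -> 2 * h <= 1 ->
  (forall i, P i -> log_box (s i) (y i) h `<=` cone X) ->
  (forall i j p, P i -> P j -> log_box (s i) (y i) h p ->
     log_box (s j) (y j) h p -> i = j) ->
  (forall i, 0 <= b i) ->
  (forall i p, P i -> log_box (s i) (y i) h p -> b i <= `|g p|) ->
  ((h * (2 * h) ^+ n.-1 * \sum_(i | P i) b i ^+ n)%:E <=
     \int[@lebesgue_point R n]_(p in cone X) (`|g p| ^+ n / p.1)%R%:E)%E.
Proof.
move=> h0 h1 sub disj b0 bg.
pose c i := if P i then b i ^+ n / expR (s i + h) else 0.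
have c0 i : 0 <= c i by rewrite /c; case: ifP => // _; rewrite divr_ge0 ?exprn_ge0 ?expR_ge0.
pose mu := @lebesgue_point R n.
have -> : (\int[mu]_(p in cone X) (`|g p| ^+ n / p.1)%R%:E =
    \int[mu]_p (((fun p => (`|g p| ^+ n / p.1)%R%:E) \_ (cone X)) p))%E.
  exact: integral_mkcond.
apply: (@le_trans _ _ (\int[mu]_p
    \sum_i ((c i)%:E * (\1_(log_box (s i) (y i) h) p)%:E))%E); last first.
  apply: ge0_le_integralT => p.
    by apply: sume_ge0 => i _; rewrite -EFinM lee_fin mulr_ge0.
  have rhs0 : (0 <= (((fun p => (`|g p| ^+ n / p.1)%R%:E) \_ (cone X)) p))%E.
    rewrite patchE; case: ifPn => // /set_mem [/= p1 _].
    by rewrite lee_fin divr_ge0 ?exprn_ge0//; move: p1; rewrite in_itv/= => /andP[/ltW].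
  have [/existsP[i /andP[Pi /asboolP ip]]|/existsPn noi] :=
      boolP [exists i, P i && `[< log_box (s i) (y i) h p >]].
    rewrite (bigD1 i)//= big1 ?adde0.
      rewrite indicE mem_set// mule1 patchE mem_set; last exact: sub Pi _ ip.
      rewrite lee_fin /c Pi ler_pM ?exprn_ge0 ?invr_ge0 ?expR_ge0//.
        by apply: lerXn2r; rewrite ?nnegrE//; exact: bg Pi ip.
      move: ip => [/=]; rewrite in_itv/= => /andP[l r] _.
      by rewrite lef_pV2 ?posrE ?expR_gt0// (lt_le_trans _ l) ?expR_gt0.
    move=> j ji; rewrite /c; case: ifPn => Pj; last by rewrite mul0e.
    rewrite indicE memNset ?mule0// => jp.
    by move/eqP: ji; apply; exact: disj jp ip.
  rewrite big1// => i _; rewrite /c; case: ifPn => Pi; last by rewrite mul0e.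
  rewrite indicE memNset ?mule0// => ip.
  by have := noi i; rewrite Pi /= => /negP; apply; apply/asboolP.
rewrite ge0_integral_sum//; last 2 first.
- move=> i; apply: measurable_funeM; apply/measurable_EFinP.
  by apply: measurable_indic; exact: measurable_log_box.
- by move=> i p _; rewrite -EFinM lee_fin mulr_ge0.
rewrite mulr_sumr -sumEFin [in leLHS]big_mkcond; apply: lee_sum => i _.
rewrite ge0_integralZl//; last 2 first.
- by apply/measurable_EFinP; apply: measurable_indic; exact: measurable_log_box.
- by rewrite lee_fin.
rewrite integral_indic//; last exact: measurable_log_box.
rewrite setIT [X in (_ * X)%E](_ : _ =
  ((expR (s i + h) - expR (s i - h)) * (2 * h) ^+ n.-1)%:E); last first.
  exact: lebesgue_log_box (ltW h0).
rewrite -EFinM /c; case: ifPn => Pi; last by rewrite mul0r.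
have -> : h * (2 * h) ^+ n.-1 * b i ^+ n = b i ^+ n * (2 * h) ^+ n.-1 * h by ring.
rewrite lee_fin mulrACA [_^-1 * _]mulrC -mulrACA.
apply: ler_wpM2l; first by rewrite mulr_ge0 ?exprn_ge0 ?b0 ?mulr_ge0 ?(ltW h0).
rewrite [leRHS]mulrC.
have -> : s i - h = s i + h - 2 * h by ring.
rewrite (expRD (s i + h)) mulrBr mulVf ?gt_eqF ?expR_gt0// mulrA mulVf ?gt_eqF ?expR_gt0// mul1r.
(* 1 - e^{-2h} >= 2 h / (1 + 2 h) >= h because 2 h <= 1. *)
have := expR_ge1Dx (2 * h).
rewrite expRN => e1; rewrite lerBrDr -lerBrDl.
apply: (@le_trans _ _ (1 + 2 * h)^-1).
  by rewrite lef_pV2 ?posrE ?expR_gt0//; lra.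
rewrite -[leLHS]mul1r ler_pdivrMr; last lra.
nra.
Qed.

End boxes.

(** * Supporting hyperplanes of convex sets *)

Section convex.
Context (R : realType) (m : nat).
Implicit Types (X : set 'rV[R]_m) (x y z : 'rV[R]_m).

Definition dotp x y : R := \sum_i x 0 i * y 0 i.

Lemma dotpC x y : dotp x y = dotp y x.
Proof. by apply: eq_bigr => i _; rewrite mulrC. Qed.

Lemma dotpDl x y z : dotp (x + y) z = dotp x z + dotp y z.
Proof. by rewrite -big_split; apply: eq_bigr => i _; rewrite mxE mulrDl. Qed.

Lemma dotpZl (a : R) x y : dotp (a *: x) y = a * dotp x y.
Proof. by rewrite /dotp mulr_sumr; apply: eq_bigr => i _; rewrite mxE mulrA. Qed.

Lemma dotpNl x y : dotp (- x) y = - dotp x y.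
Proof. by rewrite -scaleN1r dotpZl mulN1r. Qed.

Lemma dotpDr x y z : dotp x (y + z) = dotp x y + dotp x z.
Proof. by rewrite !(dotpC x) dotpDl. Qed.

Lemma dotpZr (a : R) x y : dotp x (a *: y) = a * dotp x y.
Proof. by rewrite !(dotpC x) dotpZl. Qed.

Lemma dotpNr x y : dotp x (- y) = - dotp x y.
Proof. by rewrite !(dotpC x) dotpNl. Qed.

Lemma dotpp_ge0 x : 0 <= dotp x x.
Proof. by apply: sumr_ge0 => i _; rewrite -expr2 sqr_ge0. Qed.

Lemma dotpp_eq0 x : dotp x x = 0 -> x = 0.
Proof.
move=> /eqP; rewrite psumr_eq0 => [/allP h|i _]; last by rewrite -expr2 sqr_ge0.
apply/rowP => i; have := h i; rewrite mem_index_enum => /(_ isT)/=.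
by rewrite mulf_eq0 orbb mxE => /eqP.
Qed.

(** Cauchy-Schwarz without square roots, from |D x + y|^2 >= 0. *)
Lemma dotp_unit_ge x y (D : R) : dotp x x = 1 -> 0 < D ->
  dotp y y <= D ^+ 2 -> - D <= dotp x y.
Proof.
move=> x1 D0 yD; have := dotpp_ge0 (D *: x + y).
rewrite !dotpDl !dotpDr !dotpZl !dotpZr x1 (dotpC y x).
nra.
Qed.

Lemma continuous_sum (T : topologicalType) (I : Type) (r : seq I) (P : pred I)
    (F : I -> T -> R) :
  (forall i, P i -> continuous (F i)) -> continuous (fun u => \sum_(i <- r | P i) F i u).
Proof. by apply: continuous_big; exact: add_continuous. Qed.

Lemma continuous_dotp (f g : 'rV[R]_m -> 'rV[R]_m) :
  (forall i, continuous (fun x => f x 0 i)) -> (forall i, continuous (fun x => g x 0 i)) ->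
  continuous (fun x => dotp (f x) (g x)).
Proof.
move=> cf cg; apply: continuous_sum => i _ x.
by apply: continuousM; [exact: cf|exact: cg].
Qed.

Lemma open_box X x : open X -> X x ->
  exists2 r : R, 0 < r & forall y, (forall i, `|y 0 i - x 0 i| < r) -> X y.
Proof.
move=> oX Xx; have /nbhs_ballP[r /= r0 rX] := open_nbhs_nbhs (conj oX Xx).
exists r => // y yx; apply: rX; split => // i j; rewrite ord1 /ball/= distrC; exact: yx.
Qed.

Lemma closure_box X x (r : R) : closure X x -> 0 < r ->
  exists2 y, X y & forall i, `|y 0 i - x 0 i| < r.
Proof.
move=> cX r0; have [y [Xy xy]] := cX _ (nbhsx_ballx x r r0).
by exists y => // i; have := xy.2 0 i; rewrite /ball/= distrC.
Qed.

Lemma bounded_closure_compact X : bounded_set X -> compact (closure X).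
Proof.
move=> [M [_ bX]]; apply: bounded_closed_compact; last exact: closed_closure.
exists (M + 1); split => [|r Mr y cy]; first exact: num_real.
apply: le_trans (ltW Mr); have /closure_id E : closed [set z : 'rV[R]_m | `|z| <= M + 1].
  rewrite (_ : mkset _ = (fun z : 'rV[R]_m => `|z|) @^-1` [set t : R | t <= M + 1])//.
  apply: closed_comp; last exact: closed_le.
  by move=> z _; exact: norm_continuous.
suff : [set z : 'rV[R]_m | `|z| <= M + 1] y by [].
rewrite E; move: y cy; apply: closureS => z Xz /=.
by apply: bX => //; rewrite ltrDl.
Qed.

Section convex_set.
Context (X : set 'rV[R]_m).
Hypothesis oX : open X.
Hypothesis cX : convex_set (X : set (convex_lmodType 'rV[R]_m)).

Lemma convexE x y (t : R) : X x -> X y -> 0 <= t -> t <= 1 ->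
  X (t *: x + (1 - t) *: y).
Proof.
move=> Xx Xy t0 t1.
have h : (0 : R) <= t <= 1 by rewrite t0 t1.
by have := cX (Itv01 t0 t1) (mem_set Xx) (mem_set Xy); rewrite inE.
Qed.

Lemma convex_segment x w (t : R) : X x -> closure X w -> 0 < t -> t <= 1 ->
  X (t *: x + (1 - t) *: w).
Proof.
move=> Xx Xw t0 t1; have [r r0 rX] := open_box oX Xx.
have [u Xu uw] := closure_box Xw (mulr_gt0 r0 t0).
(* The limit point w is exchanged for a nearby u in X; the error is moved to x, where the box around
   x absorbs it. *)
have -> : t *: x + (1 - t) *: w =
    t *: (x + ((1 - t) / t) *: (w - u)) + (1 - t) *: u.
  rewrite scalerDr scalerA mulrCA divff ?gt_eqF// mulr1 scalerBr.
  by rewrite -!addrA addNr addr0.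
apply: convexE => //; last exact: ltW.
apply: rX => i; rewrite !mxE [_ + _ * _]addrC addrK normrM.
rewrite ger0_norm; last by rewrite divr_ge0 ?subr_ge0 ?(ltW t0).
rewrite mulrAC ltr_pdivrMr// distrC.
apply: le_lt_trans (uw i); rewrite ler_piMl// lerBlDr lerDl; exact: ltW.
Qed.

(** A boundary point z pushed away from x leaves the closure: otherwise z would lie strictly inside
    the segment from x to a limit point of X, hence in X. *)
Lemma outside_near_boundary x z (D : R) : X x -> boundary X z ->
  dotp (x - z) (x - z) < D -> exists2 z', ~ closure X z' & dotp (x - z') (x - z') < D.
Proof.
move=> Xx [_ bz] zD.
have nXz : ~ X z.
  have : closed (~` X) by exact: open_closedC.
  by move=> /closure_id E; rewrite -E in bz.
pose q := dotp (x - z) (x - z).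
have q0 : 0 <= q by exact: dotpp_ge0.
(* With e <= 1 and 4 e (q + 1) <= D - q one gets (1 + e)^2 q < D. *)
pose e := Num.min 1 ((D - q) / (4 * (q + 1))).
have e0 : 0 < e.
  by rewrite lt_min ltr01 divr_gt0 ?subr_gt0// mulr_gt0// ltr_wpDl.
have e1 : e <= 1 by rewrite ge_min lexx.
have eq : e * (4 * (q + 1)) <= D - q.
  by rewrite -ler_pdivlMr ?ge_min ?lexx ?orbT// mulr_gt0// ltr_wpDl.
pose z' := z + e *: (z - x); exists z'.
  move=> cz'; apply: nXz.
  have e1' : 0 < 1 + e by rewrite addr_gt0.
  have -> : z = (e / (1 + e)) *: x + (1 - e / (1 + e)) *: z'.
    apply/rowP => i; rewrite !mxE; field; by rewrite gt_eqF.
  apply: convex_segment => //; first by rewrite divr_gt0.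
  by rewrite ler_pdivrMr// mul1r lerDr.
have -> : x - z' = (1 + e) *: (x - z).
  by apply/rowP => i; rewrite !mxE; ring.
have : 0 <= e * q * (1 - e) by rewrite !mulr_ge0 ?subr_ge0 ?(ltW e0).
rewrite dotpZl dotpZr -/q; have : 0 <= e * q by rewrite mulr_ge0 ?(ltW e0).
nra.
Qed.

(** The normal e points from c, the point of the closure nearest to z', towards z'. The last bound
    comes from c - x = (z' - x) - (z' - c), where z' - c has a positive component along e. *)
Lemma supporting_hyperplane x z' (D : R) : bounded_set X -> X x -> ~ closure X z' -> 0 < D ->
  dotp (x - z') (x - z') <= D ^+ 2 ->
  exists c e, [/\ dotp e e = 1, forall y, closure X y -> 0 <= dotp e (c - y) &
    dotp e (c - x) <= D].
Proof.
move=> bX Xx nz' D0 xz'.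
have cf : continuous (fun y => dotp (y - z') (y - z')).
  have h i : continuous (fun y : 'rV[R]_m => (y - z') 0 i).
    under eq_fun do rewrite !mxE; move=> y; apply: continuousB; last exact: cst_continuous.
    exact: coord_continuous.
  exact: continuous_dotp.
have [c /set_mem cX' cmin] : exists2 c, c \in closure X &
    forall t, t \in closure X -> dotp (c - z') (c - z') <= dotp (t - z') (t - z').
  apply: (@EVT_min_rV R m (fun y => dotp (y - z') (y - z'))).
  - by exists x; exact: subset_closure.
  - exact: bounded_closure_compact.
  - exact: continuous_subspaceT.
(* First-order condition at the minimiser c, obtained by moving from c towards y: for a < 0 the step
   t makes 2 t a + t^2 q negative. *)
have orth y : X y -> 0 <= dotp (y - c) (c - z').
  move=> Xy; rewrite leNgt; apply/negP.
  set a := dotp (y - c) (c - z') => a0; set q := dotp (y - c) (y - c).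
  have q0 : 0 <= q by exact: dotpp_ge0.
  pose t := Num.min 1 (- a / (q + 1)).
  have t0 : 0 < t by rewrite lt_min ltr01 divr_gt0 ?oppr_gt0// ltr_wpDl.
  have t1 : t <= 1 by rewrite ge_min lexx.
  have tq : t * (q + 1) <= - a.
    by rewrite -ler_pdivlMr ?ge_min ?lexx ?orbT// ltr_wpDl.
  have := cmin (t *: y + (1 - t) *: c).
  rewrite mem_set; last by apply: subset_closure; exact: convex_segment.
  move=> /(_ isT).
  have -> : t *: y + (1 - t) *: c - z' = (c - z') + t *: (y - c).
    by apply/rowP => i; rewrite !mxE; ring.
  have -> : dotp (c - z' + t *: (y - c)) (c - z' + t *: (y - c)) =
      dotp (c - z') (c - z') + 2 * t * a + t ^+ 2 * q.
    rewrite /a /q; move: (c - z') (y - c) => u w.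
    by rewrite !dotpDl !dotpDr !dotpZl !dotpZr (dotpC u w); ring.
  nra.
pose d := Num.sqrt (dotp (z' - c) (z' - c)).
have d0 : 0 < d.
  rewrite sqrtr_gt0 lt_neqAle dotpp_ge0 andbT; apply/eqP => /esym/dotpp_eq0/eqP.
  by rewrite subr_eq0 => /eqP E; apply: nz'; rewrite E.
have d2 : dotp (z' - c) (z' - c) = d ^+ 2 by rewrite sqr_sqrtr ?dotpp_ge0.
pose e := d^-1 *: (z' - c).
have ee : dotp e e = 1.
  by rewrite /e dotpZl dotpZr d2; field; rewrite gt_eqF.
exists c, e; split => //.
  move=> y cy; have : closed [set y | 0 <= dotp e (c - y)].
    apply: (@closed_comp _ _ (fun y => dotp e (c - y)) [set t : R | 0 <= t]).
      move=> u _; apply: (@continuous_dotp (fun=> e)) => i.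
        by move=> ?; exact: cst_continuous.
      under eq_fun do rewrite !mxE; move=> v; apply: continuousB; first exact: cst_continuous.
      exact: coord_continuous.
    exact: closed_ge.
  move=> /closure_id E; suff : [set y | 0 <= dotp e (c - y)] y by [].
  rewrite E; move: y cy; apply: closureS => y Xy /=.
  rewrite /e dotpZl mulr_ge0 ?invr_ge0 ?(ltW d0)//.
  by rewrite -(opprB y c) -(opprB c z') dotpNl dotpNr opprK dotpC orth.
have -> : c - x = (z' - x) - (z' - c) by apply/rowP => i; rewrite !mxE; ring.
have -> : dotp e (z' - x - (z' - c)) = dotp e (z' - x) - d^-1 * d ^+ 2.
  by rewrite dotpDr dotpNr -d2 -dotpZl (dotpC (d^-1 *: _)) dotpC.
have := dotp_unit_ge ee D0 xz'.
rewrite -(opprB x z') dotpNr.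
have : 0 < d^-1 * d ^+ 2 by rewrite mulr_gt0 ?invr_gt0// exprn_gt0.
lra.
Qed.

End convex_set.
End convex.

(** * Comparison *)

Section compactness.
Context (R : realType).

Lemma usc_attains_max (T : topologicalType) (A K : set T) (v phi : T -> R) :
  lower_semicontinuous (fun p : subspace A => (- v p)%:E) ->
  compact K -> K !=set0 -> K `<=` A ->
  (forall p, K p -> {for p, continuous phi}) ->
  exists2 q, K q & forall p, K p -> v p - phi p <= v q - phi q.
Proof.
move=> usc cK [k0 Kk0] KA cphi; apply: contrapT => nomax.
have {}nomax p : K p -> exists2 p', K p' & v p - phi p < v p' - phi p'.
  move=> Kp; apply: contrapT => h; apply: nomax; exists p => // p' Kp'.
  by rewrite leNgt; apply/negP => lt; apply: h; exists p'.
(* The filter of superlevel sets of v - phi in K. Near-covering compactness for it replaces a finite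
   subcover and the largest of finitely many values: it yields a k in K at which v - phi exceeds all
   its values on K, its own included. *)
pose F := filter_from K (fun k => [set k' | K k' /\ v k - phi k <= v k' - phi k']).
have FF : Filter F.
  apply: filter_from_filter; first by exists k0.
  move=> i j Ki Kj; have [ij|/ltW ji] := leP (v i - phi i) (v j - phi j).
    by exists j => // k [Kk jk]; split; split => //; exact: le_trans jk.
  by exists i => // k [Kk ik]; split; split => //; exact: le_trans ik.
have /near_covering_withinP cov := (compact_near_coveringP K).1 cK.
have [|k Kk /(_ k)] := cov _ F (fun k' p => v p - phi p < v k' - phi k') FF; last first.
  by move=> /(_ (conj Kk (lexx _)) _ Kk); rewrite ltxx.
move=> p Kp; have [p' Kp' lt] := nomax p Kp.
pose e := (v p' - phi p' - (v p - phi p)) / 2.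
have e0 : 0 < e by rewrite divr_gt0// subr_gt0.
have [V + hV] : exists2 V, nbhs (p : subspace A) V &
    forall y, V y -> ((- v p - e)%:E < (- v y)%:E)%E.
  by apply: usc; rewrite lte_fin; lra.
move=> nV; have VA : within A (nbhs p) V by rewrite nbhs_subspace_in//; exact: KA.
have phie : \forall y \near p, phi p - e < phi y.
  by apply: (cvgr_gt _ (cphi p Kp)); lra.
exists ([set y | (A y -> V y) /\ phi p - e < phi y],
        [set k' | K k' /\ v p' - phi p' <= v k' - phi k']).
  split; last by exists p'.
  by near=> y; split; [near: y; exact: VA|near: y; exact: phie].
move=> [y k'] /= [[Vy h2] [_ h3]] Ky.
have := hV y (Vy (KA _ Ky)); rewrite lte_fin => h1.
by move: h1 h2 h3; rewrite /e => h1 h2 h3; lra.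
Unshelve. all: by end_near.
Qed.

End compactness.

Section comparison.
Context (R : realType) (n : nat).
Local Notation point := (R * 'rV[R]_n.-1)%type.
Implicit Types (X : set 'rV[R]_n.-1) (p q : point) (K : set point).

Lemma closure_cone_closure X p : 0 < p.1 <= 1 -> closure X p.2 -> cone_closure X p.
Proof.
move=> /andP[p0 p1] cX; have [Xp|nXp] := pselect (X p.2).
  move: p1; rewrite le_eqVlt => /predU1P[p1|p1]; first by right; left.
  by left; split => //=; rewrite in_itv/= p0 p1.
right; right; split; first by rewrite /= in_itv/= p0 p1.
by split => //; exact: subset_closure.
Qed.

(** Let q maximise v - phi over K. If v q > S + phi q, then q is interior to K and phi is an
    admissible test function; moreover v q >= 0 gives h (v q) <= 0, and the subsolution inequality
    contradicts the strict bound on Lphi. The alternative to [nbhs p K] serves the artificial sides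
    of K. *)
Lemma viscosity_comparison X (h : R -> R) (f v phi Lphi : point -> R) (S : R) K :
  usc_on (cone_closure X) v -> viscosity_subsolution X h f v ->
  (forall a b, a <= b -> h b <= h a) -> h 0 = 0 ->
  compact K -> K `<=` cone_closure X ->
  Ck_on 2 (@half_space R n) phi -> operator_on phi Lphi ->
  0 <= S -> (forall p, K p -> 0 <= phi p) ->
  (forall p, K p -> cone_boundary X p -> v p <= S) ->
  (forall p, K p -> cone X p -> nbhs p K \/ v p <= S + phi p) ->
  (forall p, K p -> cone X p -> Lphi p < p.1 ^+ 2 * f p) ->
  forall p, K p -> v p <= S + phi p.
Proof.
move=> usc [_ sub] hdec h0 cK Kcl Cphi Lop S0 phi0 vbd vK Llt p Kp.
have clU q : cone_closure X q -> half_space q.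
  move=> [[/= q1 _]|[[/= q1 _]|[/= q1 _]]].
  - by move: q1; rewrite /half_space/= in_itv/= => /andP[].
  - by rewrite /half_space/= q1.
  - by move: q1; rewrite /half_space/= in_itv/= => /andP[].
have [q Kq qmax] : exists2 q, K q & forall p, K p -> v p - phi p <= v q - phi q.
  apply: (@usc_attains_max R point (cone_closure X) K v phi) => //; first by exists p.
  by move=> q /Kcl/clU; exact: Cphi.1.
have vq : v q - phi q <= S -> v p <= S + phi p.
  by move=> le; rewrite -lerBlDr; exact: le_trans (qmax p Kp) le.
apply: vq; have phiq := phi0 _ Kq.
case: (Kcl _ Kq) => [cq|bq]; last by have := vbd _ Kq bq; lra.
case: (vK _ Kq cq) => [nK|]; last lra.
rewrite leNgt; apply/negP => Slt.
have /= := sub phi (Ck_on_subset (fun q cq => clU q (or_introl cq)) Cphi) q cq.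
have -> : q.1 ^- 2 * cone_laplacian phi q + q.1 ^- 2 * (n%:R - 2) * t_dt phi q =
    q.1 ^- 2 * cone_operator phi q by rewrite /cone_operator; ring.
have q0 : 0 < q.1 by apply: clU; left.
rewrite (operator_onE Lop)// => /(_ _)/wrap[].
  by apply: filterS nK => p' /qmax.
have vq0 : 0 <= v q by lra.
have := hdec _ _ vq0; rewrite h0 => hv0.
have := Llt _ Kq cq; rewrite -ltr_pdivrMl ?exprn_gt0//.
lra.
Qed.

End comparison.

(** * A supporting half-space close to an interior point *)

Section halfspace.
Context (R : realType) (n : nat).
Local Notation point := (R * 'rV[R]_n.-1)%type.

Lemma halfspace_near (X : set 'rV[R]_n.-1) (x0 : 'rV[R]_n.-1) (d0 : R) :
  open X -> bounded_set X -> convex_set (X : set (convex_lmodType 'rV[R]_n.-1)) ->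
  0 < d0 -> X x0 -> (forall p : point, cone X p -> cone_boundary_dist X p <= d0) ->
  exists c e, [/\ dotp e e = 1, forall y, closure X y -> 0 <= dotp e (c - y) &
    dotp e (c - x0) <= 2 * d0].
Proof.
move=> oX bX cX d0_gt0 Xx0 hd.
have d02 : 0 < 2 * d0 by rewrite mulr_gt0.
(* At logarithmic depth 2 d0 the face t = 1 is too far away to realise a distance below 2 d0, so a
   near boundary point must lie over the boundary of X. *)
pose p : point := (expR (- (2 * d0)), x0).
have cp : cone X p.
  by split => //=; rewrite in_itv/= expR_gt0/= expR_lt1 oppr_lt0.
have [z bz xz] : exists2 z, boundary X z & dotp (x0 - z) (x0 - z) < (2 * d0) ^+ 2.
  have := le_lt_trans (hd p cp) (_ : d0 < 2 * d0) => /(_ _)/wrap[]; first lra.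
  move=> /inf_lt[|_ [q bq <-] lt].
    by exists (cone_dist p (1, x0)); exists (1, x0) => //; left.
  have sq : (ln p.1 - ln q.1) ^+ 2 + \sum_i (p.2 0 i - q.2 0 i) ^+ 2 < (2 * d0) ^+ 2.
    rewrite -ltr_sqrt ?exprn_gt0// sqrtr_sqr gtr0_norm//.
  have sum0 : 0 <= \sum_i (p.2 0 i - q.2 0 i) ^+ 2.
    by apply: sumr_ge0 => i _; exact: sqr_ge0.
  case: bq => [[/= q1 _]|[_ bq]].
    move: sq; rewrite /= expRK q1 ln1 subr0 sqrrN => sq.
    by exfalso; move: sum0; rewrite /=; lra.
  exists q.2 => //.
  have -> : dotp (x0 - q.2) (x0 - q.2) = \sum_i (p.2 0 i - q.2 0 i) ^+ 2.
    by apply: eq_bigr => i _; rewrite !mxE expr2.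
  have : 0 <= (ln p.1 - ln q.1) ^+ 2 by exact: sqr_ge0.
  lra.
have [z' nz' xz'] := outside_near_boundary oX cX Xx0 bz xz.
exact: (supporting_hyperplane oX cX bX Xx0 nz' d02 (ltW xz')).
Qed.

End halfspace.

(** * The barrier *)

Lemma expR_le_ln (R : realType) (a t : R) : 0 < t -> (expR a <= t) = (a <= ln t).
Proof. by move=> t0; rewrite -{1}[t]lnK ?posrE// ler_expR. Qed.

Lemma le_expR_ln (R : realType) (a t : R) : 0 < t -> (t <= expR a) = (ln t <= a).
Proof. by move=> t0; rewrite -{1}[t]lnK ?posrE// ler_expR. Qed.

Section cylinder.
Context (R : realType) (n : nat).
Local Notation point := (R * 'rV[R]_n.-1)%type.
Implicit Types (X : set 'rV[R]_n.-1) (p q : point) (tau : R).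

Definition cylinder X p0 tau : set point :=
  [set p | [/\ 0 < p.1 <= 1, closure X p.2, `|tdiff (ln p0.1) p| <= tau ^+ 2 &
     xsqdist p0.2 p <= tau ^+ 2]].

Lemma cylinder_closure X p0 tau : cylinder X p0 tau `<=` cone_closure X.
Proof. by move=> p [p01 cX _ _]; exact: closure_cone_closure. Qed.

Lemma continuous_xsqdist y : continuous (@xsqdist R n y).
Proof.
apply: continuous_sum => i _.
have h : continuous (@xdiff R n y i).
  by move=> p; apply: continuousB; [exact: continuous_coord|exact: cst_continuous].
move=> p; exact: (continuousM (h p) (h p)).
Qed.

Lemma compact_cylinder X p0 tau : bounded_set X -> compact (cylinder X p0 tau).
Proof.
move=> bX; set s := ln p0.1; set T := tau ^+ 2.
have cK : compact (`[expR (s - T), 1]%classic `*` closure X : set point).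
  by apply: compact_setX; [exact: segment_compact|exact: bounded_closure_compact].
have cE : cylinder X p0 tau =
    (`[expR (s - T), 1]%classic `*` closure X) `&`
    (fst @^-1` [set t | t <= expR (s + T)] `&` xsqdist p0.2 @^-1` [set t | t <= T]).
  apply/seteqP; split => p /=.
    move=> [/andP[p1 p2] cp]; rewrite ler_norml /tdiff -/s -/T => /andP[h1 h2] h3.
    rewrite in_itv/= p2 andbT expR_le_ln// le_expR_ln//.
    by do !split => //; lra.
  rewrite in_itv/= => -[[/andP[h1 h2] cp] [h3 h4]].
  have p1 : 0 < p.1 by rewrite (lt_le_trans _ h1) ?expR_gt0.
  split => //; first by rewrite p1 h2.
  move: h1 h3; rewrite expR_le_ln// le_expR_ln// /tdiff -/s -/T ler_norml => h1 h3.
  by apply/andP; split; lra.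
rewrite cE; apply: (subclosed_compact _ cK); last by move=> p [].
apply: closedI; first by apply: compact_closed cK; exact: norm_hausdorff.
apply: closedI.
  by apply: closed_comp; [move=> p _; exact: cvg_fst|exact: closed_le].
by apply: closed_comp; [move=> p _; exact: continuous_xsqdist|exact: closed_le].
Qed.

Lemma cylinder_nbhs X p0 tau p : open X -> cone X p ->
  `|tdiff (ln p0.1) p| < tau ^+ 2 -> xsqdist p0.2 p < tau ^+ 2 ->
  nbhs p (cylinder X p0 tau).
Proof.
move=> oX [/=]; rewrite in_itv/= => /andP[p1 p2] Xp h1 h2.
have ct : {for p, continuous (fun q : point => `|tdiff (ln p0.1) q|)}.
  apply: (@continuous_comp _ _ _ (tdiff (ln p0.1)) (fun t : R => `|t|)); last first.
    exact: norm_continuous.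
  by have [h _] := @Ck_on_tdiff R n (ln p0.1) 0; exact: h.
near=> q; split.
- apply/andP; split; last apply: ltW; near: q.
    by apply: (cvgr_gt _ cvg_fst).
  by apply: (cvgr_lt _ cvg_fst).
- apply: subset_closure; near: q.
  have : (fst \o (fun q : point => (q.2, q.1)))%FUN @ p --> p.2 by exact: cvg_snd.
  by move=> /(_ X); apply; exact: open_nbhs_nbhs.
- by apply: ltW; near: q; apply: (cvgr_lt _ ct).
- by apply: ltW; near: q; apply: (cvgr_lt _ (@continuous_xsqdist p0.2 p)).
Unshelve. all: by end_near.
Qed.

End cylinder.

Section barrier.
Context (R : realType) (n : nat).
Local Notation point := (R * 'rV[R]_n.-1)%type.
Context (N s : R) (x0 c e : 'rV[R]_n.-1) (d tau : R).

(** A makes the term in - 2 A of [barrier_operator] outweigh the other two on the cylinder; Y bounds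
    the level l there, so that l (2 Y - l) is nonnegative. *)
Let A : R := (2 * N - 2) / tau ^+ 2.
Let Y : R := d + tau.

(* Parabolic scaling: in time tau^2 the drift moves s by O(tau^2), x diffuses by O(tau). *)
Definition barrier (p : point) : R :=
  (tau ^+ 4)^-1 * tdiff s p ^+ 2 + (tau ^+ 2)^-1 * xsqdist x0 p +
  (2 * A * Y * level c e p + - A * level c e p ^+ 2).

Definition barrier_operator (p : point) : R :=
  (tau ^+ 4)^-1 * (2 + 2 * (N - 2) * tdiff s p) +
  (tau ^+ 2)^-1 * (2 * (N - 1)) - 2 * A * dotp e e.

Lemma operator_on_barrier : (0 < n)%N -> N = n%:R -> operator_on barrier barrier_operator.
Proof.
move=> n_gt0 NE.
have H := operator_onD (operator_onD
  (operator_onZ (tau ^+ 4)^-1 (@operator_on_tdiff2 R n s))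
  (operator_onZ (tau ^+ 2)^-1 (operator_on_xsqdist n_gt0 x0)))
  (operator_onD (operator_onZ (2 * A * Y) (@operator_on_level R n c e))
  (operator_onZ (- A) (@operator_on_level2 R n c e))).
apply: eq_operator_on H => // p _ /=.
have -> : \sum_i e 0 i ^+ 2 = dotp e e by apply: eq_bigr => i _; rewrite expr2.
by rewrite /barrier_operator NE; ring.
Qed.

Lemma Ck_on_barrier k : Ck_on k (@half_space R n) barrier.
Proof.
have oU := @open_half_space R n.
have hl := @Ck_on_level R n c e k; have ht := @Ck_on_tdiff R n s k.
have Z (a : R) f : Ck_on k (@half_space R n) f -> Ck_on k (@half_space R n) (cst a \* f).
  by move=> ?; apply: Ck_onM => //; exact: Ck_on_cst.
apply: eq_Ck_on (Ck_onD oU (Ck_onD oU (Z (tau ^+ 4)^-1 _ (Ck_onM oU ht ht))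
  (Z (tau ^+ 2)^-1 _ (@Ck_on_xsqdist R n x0 k))) (Ck_onD oU (Z (2 * A * Y) _ hl)
  (Z (- A) _ (Ck_onM oU hl hl)))) => // p _.
Qed.

Hypothesis N_ge3 : 3 <= N.
Hypothesis tau_ge1 : 1 <= tau.
Hypothesis d_ge0 : 0 <= d.

Let T_ge1 : 1 <= tau ^+ 2.
Proof. by rewrite exprn_ege1. Qed.

Let T_gt0 : 0 < tau ^+ 2.
Proof. exact: lt_le_trans T_ge1. Qed.

Let A_ge0 : 0 <= A.
Proof. by have N3 := N_ge3; rewrite /A; apply: divr_ge0; [lra|exact: ltW]. Qed.

(** After multiplication by tau^2, and with tdiff <= tau^2, the operator is at most 2 / tau^2 + 2 (N
    - 2) + 2 (N - 1) - 4 (N - 1) = 2 / tau^2 - 2, and tau >= 1. *)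
Lemma barrier_operator_le0 p : dotp e e = 1 -> `|tdiff s p| <= tau ^+ 2 ->
  barrier_operator p <= 0.
Proof.
have N3 := N_ge3; have t1 := tau_ge1; have d1 := d_ge0; have T1 := T_ge1; have T0 := T_gt0.
move=> ee; rewrite ler_norml => /andP[_ h]; rewrite /barrier_operator ee /A.
have -> : tau ^+ 4 = tau ^+ 2 * tau ^+ 2 by rewrite -exprD.
set T := tau ^+ 2 in T1 T0 h *.
have -> : (T * T)^-1 * (2 + 2 * (N - 2) * tdiff s p) + T^-1 * (2 * (N - 1)) -
    2 * ((2 * N - 2) / T) * 1 =
    (T * T)^-1 * (2 + 2 * (N - 2) * tdiff s p - 2 * (N - 1) * T).
  by field; rewrite gt_eqF.
have TT : 0 < (T * T)^-1 by rewrite invr_gt0; exact: mulr_gt0.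
rewrite pmulr_rle0//.
have : 0 <= (N - 2) * (T - tdiff s p) by rewrite mulr_ge0//; lra.
lra.
Qed.

Let level_ge0 p : 0 <= level c e p -> level c e p <= d + tau ->
  0 <= 2 * A * Y * level c e p + - A * level c e p ^+ 2.
Proof.
have N3 := N_ge3; have t1 := tau_ge1; have d1 := d_ge0; have T1 := T_ge1; have T0 := T_gt0.
move=> l0 l1; have -> : 2 * A * Y * level c e p + - A * level c e p ^+ 2 =
  A * (level c e p * (2 * Y - level c e p)) by ring.
by apply: mulr_ge0; [exact: A_ge0|apply: mulr_ge0 => //; rewrite /Y; lra].
Qed.

Lemma barrier_ge0 p : 0 <= level c e p -> level c e p <= d + tau -> 0 <= barrier p.
Proof.
have N3 := N_ge3; have t1 := tau_ge1; have d1 := d_ge0; have T1 := T_ge1; have T0 := T_gt0.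
move=> l0 l1; rewrite /barrier addr_ge0//; last exact: level_ge0.
have tau0 : 0 <= tau by lra.
by apply: addr_ge0; apply: mulr_ge0; rewrite ?invr_ge0 ?sqr_ge0 ?exprn_ge0 ?xsqdist_ge0.
Qed.

Lemma barrier_ge1 p : 0 <= level c e p -> level c e p <= d + tau ->
  tau ^+ 2 <= `|tdiff s p| \/ tau ^+ 2 <= xsqdist x0 p -> 1 <= barrier p.
Proof.
have N3 := N_ge3; have t1 := tau_ge1; have d1 := d_ge0; have T1 := T_ge1; have T0 := T_gt0.
move=> l0 l1 far; have := level_ge0 l0 l1; rewrite /barrier.
have h1 : 0 <= (tau ^+ 4)^-1 * tdiff s p ^+ 2.
  by rewrite mulr_ge0 ?sqr_ge0// invr_ge0 (exprM _ 2 2) sqr_ge0.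
have h2 : 0 <= (tau ^+ 2)^-1 * xsqdist x0 p.
  by rewrite mulr_ge0 ?xsqdist_ge0// invr_ge0 ltW.
suff : 1 <= (tau ^+ 4)^-1 * tdiff s p ^+ 2 \/ 1 <= (tau ^+ 2)^-1 * xsqdist x0 p.
  by move=> [] ? ?; lra.
case: far => far; [left|right]; last by rewrite ler_pdivlMl// mulr1.
have T4 : 0 < tau ^+ 4 by rewrite exprn_gt0//; lra.
rewrite ler_pdivlMl// mulr1 (exprM _ 2 2) -[leRHS]real_normK ?num_real//.
by apply: lerXn2r; rewrite ?nnegrE ?(ltW T_gt0).
Qed.

(** Only the level part survives at the centre; it is at most 2 A Y d <= 8 N d / tau, by A <= 2 N /
    tau^2 and Y <= 2 tau. *)
Lemma barrier_center_le p : tdiff s p = 0 -> xsqdist x0 p = 0 ->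
  0 <= level c e p -> level c e p <= d -> 16 * N * d <= tau -> barrier p <= 2^-1.
Proof.
have N3 := N_ge3; have t1 := tau_ge1; have d1 := d_ge0; have T1 := T_ge1; have T0 := T_gt0.
move=> t0 x0' l0 l1 dtau; rewrite /barrier t0 x0' expr0n/= !mulr0 !add0r.
have dl : d <= tau by apply: le_trans dtau; nra.
apply: (@le_trans _ _ (2 * A * Y * d)).
  have hAY : 0 <= A * Y by apply: mulr_ge0; [exact: A_ge0|rewrite /Y; lra].
  have hAl : 0 <= A * level c e p ^+ 2.
    by apply: mulr_ge0; [exact: A_ge0|exact: sqr_ge0].
  have hl : A * Y * level c e p <= A * Y * d by rewrite ler_wpM2l.
  lra.
rewrite /A /Y; have -> : 2 * ((2 * N - 2) / tau ^+ 2) * (d + tau) * d =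
    (2 * (2 * N - 2) * (d + tau) * d) / tau ^+ 2 by ring.
rewrite ler_pdivrMr//.
have h1 : N * d * (d + tau) <= N * d * (2 * tau).
  by rewrite ler_wpM2l ?mulr_ge0//; lra.
have h2 : 0 <= d * (d + tau) by rewrite mulr_ge0//; lra.
have h3 : 16 * N * d * tau <= tau * tau by rewrite ler_wpM2r//; lra.
lra.
Qed.

End barrier.

(** * Reduction to the construction of a supersolution *)

Section supersolution_estimate.
Context (R : realType) (n : nat).
Hypothesis n_ge3 : (3 <= n)%N.
Local Notation point := (R * 'rV[R]_n.-1)%type.

(** The level of p0 is at most 2 d0 and [barrier_center_le] asks for 16 n (2 d0) <= tau; the summand
    1 ensures tau >= 1. *)
Definition barrier_radius (d0 : R) : R := 1 + 32 * n%:R * d0.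

Lemma barrier_radius_ge (d0 : R) : 0 < d0 ->
  1 <= barrier_radius d0 /\ 16 * n%:R * (2 * d0) <= barrier_radius d0.
Proof.
move=> d00; have := ler0n R n; rewrite /barrier_radius; set N : R := n%:R => N0.
have : 0 <= N * d0 by rewrite mulr_ge0// ltW.
by split; lra.
Qed.

(** The comparison function is phi = w + (M - S) B with the barrier B. As L B <= 0, the strict
    inequality for w survives; on the sides of the cylinder B >= 1 gives S + phi >= M >= v. *)
Lemma supersolution_estimate (X : set 'rV[R]_n.-1) (h : R -> R)
    (f v w Lw : point -> R) (S M d0 : R) (p0 : point) (K := cylinder X p0 (barrier_radius d0)) :
  open X -> bounded_set X -> convex_set (X : set (convex_lmodType 'rV[R]_n.-1)) ->
  0 < d0 -> (forall p, cone X p -> cone_boundary_dist X p <= d0) ->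
  usc_on (cone_closure X) v -> viscosity_subsolution X h f v ->
  (forall a b, a <= b -> h b <= h a) -> h 0 = 0 ->
  0 <= S -> S <= M ->
  (forall p, cone X p -> v p <= M) -> (forall p, cone_boundary X p -> v p <= S) ->
  cone X p0 ->
  Ck_on 2 (@half_space R n) w -> operator_on w Lw ->
  (forall p, K p -> 0 <= w p) ->
  (forall p, K p -> cone X p -> Lw p < p.1 ^+ 2 * f p) ->
  v p0 <= S + (w p0 + (M - S) / 2).
Proof.
move=> oX bX cX d0_gt0 hd usc sub hdec h0 S0 SM vM vS cp0 Cw ow w0 Lwf.
have [x0X p01] : X p0.2 /\ 0 < p0.1 < 1 by case: cp0.
have [c [e [ee cle lev0]]] := halfspace_near oX bX cX d0_gt0 x0X hd.
set tau := barrier_radius d0 in K w0 Lwf *.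
have N3 : 3 <= n%:R :> R by rewrite (ler_nat _ 3).
have [tau1 tau16] := barrier_radius_ge d0_gt0.
rewrite -/tau in tau1 tau16.
have T1 : 1 <= tau ^+ 2 by rewrite exprn_ege1.
have levE p : level c e p = dotp e (c - p.2) by apply: eq_bigr => i _; rewrite !mxE.
(* The level is at most 2 d0 at p0, and a displacement of length at most tau in x changes it by at
   most tau. *)
have K_level p : K p -> 0 <= level c e p /\ level c e p <= 2 * d0 + tau.
  move=> [_ cp _ xp]; rewrite levE; split; first exact: cle.
  have -> : c - p.2 = (c - p0.2) - (p.2 - p0.2) by apply/rowP => i; rewrite !mxE; ring.
  have xp' : dotp (p.2 - p0.2) (p.2 - p0.2) <= tau ^+ 2.
    by apply: le_trans xp; apply: ler_sum => i _; rewrite !mxE -expr2.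
  have := dotp_unit_ge ee (lt_le_trans ltr01 tau1) xp'.
  rewrite (dotpDr e (c - p0.2)) dotpNr; lra.
have td0 : tdiff (ln p0.1) p0 = 0 by rewrite /tdiff subrr.
have xd0 : xsqdist p0.2 p0 = 0.
  by rewrite /xsqdist big1// => i _; rewrite /xdiff subrr expr0n.
have Kp0 : K p0.
  move: p01 => /andP[p00 p01]; split; [by rewrite p00 ltW|exact: subset_closure| |].
    by rewrite td0 normr0; lra.
  by rewrite xd0; lra.
pose B := barrier n%:R (ln p0.1) p0.2 c e (2 * d0) tau.
have B0 p : K p -> 0 <= B p.
  by move=> /K_level[l0 l1]; apply: barrier_ge0 => //; lra.
have d02 : 0 <= 2 * d0 by lra.
have Bp0 : B p0 <= 2^-1.
  apply: barrier_center_le => //; first by have [] := K_level _ Kp0.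
  by rewrite levE.
have oU := @open_half_space R n.
have MS : 0 <= M - S by lra.
have CB := @Ck_on_barrier R n n%:R (ln p0.1) p0.2 c e (2 * d0) tau 2.
have n_gt0 : (0 < n)%N by case: (n) n_ge3.
have oB := @operator_on_barrier R n n%:R (ln p0.1) p0.2 c e (2 * d0) tau n_gt0 erefl.
have Cphi : Ck_on 2 (@half_space R n) (w \+ (cst (M - S) \* B)).
  apply: Ck_onD; [exact: oU|exact: Cw|].
  by apply: Ck_onM; [exact: oU|exact: Ck_on_cst|exact: CB].
have Lphi := operator_onD ow (operator_onZ (M - S) oB).
have cK : compact K by exact: compact_cylinder.
have MB0 p : K p -> 0 <= (M - S) * B p by move=> Kp; apply: mulr_ge0 => //; exact: B0.
have phi0 p : K p -> 0 <= (w \+ (cst (M - S) \* B)) p.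
  by move=> Kp; apply: addr_ge0; [exact: w0|exact: MB0].
have vbd p : K p -> cone_boundary X p -> v p <= S by move=> _ /vS.
have big p : K p -> cone X p -> 1 <= B p -> v p <= S + (w \+ (cst (M - S) \* B)) p.
  move=> Kp cp B1; have := vM p cp; have := w0 p Kp.
  have : (M - S) * 1 <= (M - S) * B p by rewrite ler_wpM2l.
  by rewrite /=; lra.
have vK p : K p -> cone X p -> nbhs p K \/ v p <= S + (w \+ (cst (M - S) \* B)) p.
  move=> Kp cp; have [l0 l1] := K_level p Kp.
  have [t1|t1] := ltP `|tdiff (ln p0.1) p| (tau ^+ 2); last first.
    by right; apply: big => //; apply: barrier_ge1 => //; left.
  have [t2|t2] := ltP (xsqdist p0.2 p) (tau ^+ 2); last first.
    by right; apply: big => //; apply: barrier_ge1 => //; right.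
  by left; exact: cylinder_nbhs.
have Llt p : K p -> cone X p ->
    (Lw \+ (cst (M - S) \* barrier_operator n%:R (ln p0.1) e tau)) p < p.1 ^+ 2 * f p.
  move=> Kp cp; have [_ _ tp _] := Kp.
  have LB : barrier_operator n%:R (ln p0.1) e tau p <= 0 by exact: barrier_operator_le0.
  have : (M - S) * barrier_operator n%:R (ln p0.1) e tau p <= 0 by exact: mulr_ge0_le0.
  by have := Lwf p Kp cp; rewrite /=; lra.
have := viscosity_comparison usc sub hdec h0 cK (@cylinder_closure _ _ _ _ _) Cphi Lphi
  S0 phi0 vbd vK Llt Kp0.
move=> /le_trans; apply; rewrite lerD2l/= lerD2l.
by rewrite ler_wpM2l.
Qed.

End supersolution_estimate.

(** * Bounds on the potentials *)

Section uniform_continuity.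
Context (R : realType) (n : nat).
Local Notation point := (R * 'rV[R]_n.-1)%type.

(** The cut-off a <= p.1 restores compactness, with [a, 1] times the closure of X; only p has to
    stay in this set. *)
Lemma within_unif_continuous (X : set 'rV[R]_n.-1) (g : point -> R) (a eta : R) :
  bounded_set X -> {within cone_closure X, continuous g} -> 0 < a -> 0 < eta ->
  exists2 theta, 0 < theta & forall p q : point, cone X p -> cone X q ->
    a <= p.1 -> `|p.1 - q.1| < theta -> (forall i, `|p.2 0 i - q.2 0 i| < theta) ->
    `|g p - g q| < eta.
Proof.
move=> bX /subspace_continuousP gc a0 eta0.
pose K : set point := `[a, 1]%classic `*` closure X.
have cK : compact K.
  by apply: compact_setX; [exact: segment_compact|exact: bounded_closure_compact].
have KA : K `<=` cone_closure X.
  move=> p [/=]; rewrite in_itv/= => /andP[p1 p2] cp.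
  by apply: closure_cone_closure => //; rewrite p2 (lt_le_trans a0 p1).
have cov := (compact_near_coveringP K).1 cK.
pose P (theta : R) (p : point) := forall q, cone_closure X q -> cone_closure X p ->
  ball p theta q -> `|g p - g q| < eta.
have : \forall theta \near (0 : R)^'+, K `<=` P theta.
  apply: cov => p Kp.
  have eta2 : 0 < eta / 2 by rewrite divr_gt0.
  have : \forall q \near p, cone_closure X q -> `|g p - g q| < eta / 2.
    by have /cvgrPdist_lt/(_ _ eta2) := gc p (KA p Kp).
  move=> /nbhs_ballP[r /= r0 hr].
  exists (ball p (r / 2), [set theta | 0 < theta < r / 2]).
    split => /=; first by apply: nbhsx_ballx; rewrite divr_gt0.
    near=> t; apply/andP; split; first by near: t; exact: nbhs_right_gt.
    by near: t; apply: nbhs_right_lt; rewrite divr_gt0.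
  move=> [p' theta] /= [pp' /andP[t0 t1]] q Aq Ap' p'q.
  have rr : r / 2 + r / 2 = r by field.
  have hp' : ball p r p' by apply: le_ball pp'; lra.
  have hq : ball p r q.
    by rewrite -rr; apply: ball_triangle pp' _; apply: le_ball p'q; exact: ltW.
  have h1 := hr _ hp' Ap'; have h2 := hr _ hq Aq.
  have := ler_distD (g p) (g p') (g q).
  rewrite (distrC (g p') (g p)); lra.
move=> hP.
have /filter_ex[theta [theta0 hK]] : \forall theta \near (0 : R)^'+, 0 < theta /\ K `<=` P theta.
  by near=> t; split; near: t => //; exact: nbhs_right_gt.
exists theta => // p q cp cq ap pq1 pq2; apply: hK => //; do ?by left.
  move: cp => [/=]; rewrite in_itv/= => /andP[_ p1] Xp.
  by split; [rewrite /= in_itv/= ap ltW|exact: subset_closure].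
by split; [|split => // i j; rewrite ord1 /ball/=; exact: pq2].
Unshelve. all: by end_near.
Qed.

End uniform_continuity.

(** * A weighted Young inequality and rounding to grid points *)

Section grid.
Context (R : realType).

Lemma natpow_expR_ln (r : R) (n : nat) : (2 <= n)%N -> 0 < r ->
  expR (- (n%:R - 2) * ln r) = r ^- (n - 2).
Proof.
move=> n2 r0; have -> : n%:R - 2 = (n - 2)%:R :> R by rewrite natrB.
by rewrite mulNr expRN expRM_natl lnK ?posrE.
Qed.

(** Two cases. If a r <= N0, then a r^{2-n} = (a r) r^{1-n} <= N0 r^{1-n}. Otherwise 1 / r <= a /
    N0, and a r^{2-n} = a r r^{1-n} <= a D (a / N0)^{n-1}. The parameter N0 will be close to the L^n
    norm, which makes both sums comparable to it. *)
Lemma young_grid (n : nat) (a r D N0 : R) : (3 <= n)%N -> 0 <= a -> 0 < r -> r <= D -> 0 < N0 ->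
  a * r ^- (n - 2) <= D * (a ^+ n / N0 ^+ n.-1) + N0 * r ^- n.-1.
Proof.
case: n => [|[|[|m]]]// _ a0 r0 rD N00; rewrite !subSS subn0 /=.
have D0 : 0 < D by exact: lt_le_trans rD.
have rE : r ^- m.+1 = r * r ^- m.+2.
  by rewrite [in RHS]exprS invfM mulrA divff ?mul1r// gt_eqF.
have rm : 0 <= r ^- m.+2 by rewrite invr_ge0 exprn_ge0// ltW.
rewrite rE; have [h|/ltW h] := leP (a * r) N0.
  apply: ler_wpDl; first by rewrite mulr_ge0 ?(ltW D0)// divr_ge0 ?exprn_ge0 ?(ltW N00).
  by rewrite mulrA ler_wpM2r.
apply: ler_wpDr; first by rewrite mulr_ge0// ltW.
have -> : D * (a ^+ m.+3 / N0 ^+ m.+2) = a * (D * (a / N0) ^+ m.+2).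
  by rewrite (exprS a) expr_div_n; ring.
rewrite ler_wpM2l// ler_pM// ?(ltW r0)// -exprVn.
apply: lerXn2r; rewrite ?nnegrE ?invr_ge0 ?divr_ge0 ?(ltW r0) ?(ltW N00)//.
by rewrite ler_pdivlMr// ler_pdivrMl// mulrC.
Qed.

Lemma offset_cell (N : nat) (delta u : R) : 0 < delta -> `|u| <= N%:R * delta ->
  exists k : 'I_(N.*2.+1), `|u - delta * offset R k| <= delta.
Proof.
move=> d0 hu; pose y := u / delta + N%:R.
have uE : u = delta * (y - N%:R) by rewrite /y; field; rewrite gt_eqF.
have hy : `|y - N%:R| <= N%:R.
  by move: hu; rewrite {1}uE normrM gtr0_norm// mulrC ler_pM2r.
move: hy; rewrite ler_norml => /andP[y0 y1].
have yge0 : 0 <= y by lra.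
have /andP[k1 k2] := Num.Theory.truncn_itv yge0.
have kM : (Num.truncn y < N.*2.+1)%N.
  by rewrite ltnS -(ler_nat R) -addnn natrD; lra.
exists (Ordinal kM); rewrite {1}uE -mulrBr /offset/= normrM gtr0_norm//.
rewrite ler_piMr ?(ltW d0)// ler_norml; move: k2; rewrite -natr1 => k2.
by apply/andP; split; lra.
Qed.


End grid.

(** * Size of a single potential *)

Section potential_bounds.
Context (R : realType) (n : nat).
Local Notation point := (R * 'rV[R]_n.-1)%type.
Implicit Types (p : point) (y : 'rV[R]_n.-1).

(** Product of lower bounds, up to powers of delta, for e^{- b tdiff}, rho^{- b} and 2 b n delta^2 /
    rho^2 on the cell of the pole, where |tdiff| <= delta <= 1 and rho <= (n + 1) delta^2. *)
Definition cell_const : R := expR (- ((n%:R - 2) / 2)) *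
  expR (- ((n%:R - 2) / 2) * ln (n%:R + 1)) * ((n%:R - 2) * n%:R / (n%:R + 1) ^+ 2).

Lemma cell_const_gt0 : (3 <= n)%N -> 0 < cell_const.
Proof.
move=> n3; have : 3 <= n%:R :> R by rewrite (ler_nat _ 3).
rewrite /cell_const; set N : R := n%:R => N3.
by rewrite !mulr_gt0 ?expR_gt0 ?invr_gt0 ?exprn_gt0//; lra.
Qed.

Lemma potential_cell (s : R) y (delta : R) p : (3 <= n)%N -> 0 < delta -> delta <= 1 ->
  `|tdiff s p| <= delta -> (forall i, `|xdiff y i p| <= delta) ->
  cell_const * delta ^- n <= potential s y delta p *
    (((n%:R - 2) / 2) ^+ 2 + 2 * ((n%:R - 2) / 2) * n%:R * delta ^+ 2 / rho s y delta p ^+ 2).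
Proof.
move=> n3 d0 d1 ts xs; have N3 : 3 <= n%:R :> R by rewrite (ler_nat _ 3).
have sq (u : R) : `|u| <= delta -> u ^+ 2 <= delta ^+ 2.
  by move=> h; rewrite -[leLHS]real_normK ?num_real//; apply: lerXn2r; rewrite ?nnegrE ?(ltW d0).
have xle : xsqdist y p <= (n%:R - 1) * delta ^+ 2.
  apply: (@le_trans _ _ (\sum_(i < n.-1) delta ^+ 2)).
    by apply: ler_sum => i _; exact: sq.
  have -> : n%:R - 1 = (n.-1)%:R :> R by rewrite -[in LHS](prednK (ltnW (ltnW n3))) -natr1 addrK.
  by rewrite sumr_const card_ord mulr_natl.
have rle : rho s y delta p <= (n%:R + 1) * delta ^+ 2.
  by have := sq _ ts; rewrite /rho; lra.
have r0 := rho_gt0 s y d0 p.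
set b := (n%:R - 2) / 2; set N : R := n%:R in N3 xle rle b *.
have b0 : 0 <= b by rewrite /b; lra.
have N1 : 0 < N + 1 by lra.
have d2 : 0 < delta ^+ 2 by rewrite exprn_gt0.
have e1 : expR (- b) <= expR (- b * tdiff s p).
  rewrite ler_expR; have : tdiff s p <= 1.
    by apply: le_trans d1; apply: le_trans ts; exact: ler_norm.
  by move=> t1; have : b * tdiff s p <= b * 1 by [rewrite ler_wpM2l]; lra.
have dn : delta ^- (n - 2) = expR (- (2 * b) * ln delta).
  by rewrite -natpow_expR_ln ?(ltnW n3)// (_ : 2 * b = N - 2)//; rewrite /b; field.
have e2 : expR (- b * ln (N + 1)) * delta ^- (n - 2) <= expR (- b * ln (rho s y delta p)).
  rewrite dn -expRD ler_expR.
  have -> : - b * ln (N + 1) + - (2 * b) * ln delta = - b * ln ((N + 1) * delta ^+ 2).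
    by rewrite lnM ?posrE// lnXn// mulr2n; ring.
  by rewrite ler_wnM2l ?oppr_le0// ler_ln ?posrE// mulr_gt0.
have e3 : (N - 2) * N / (N + 1) ^+ 2 * delta ^- 2 <=
    b ^+ 2 + 2 * b * N * delta ^+ 2 / rho s y delta p ^+ 2.
  apply: ler_wpDl; first exact: sqr_ge0.
  have -> : (N - 2) * N / (N + 1) ^+ 2 * delta ^- 2 =
      2 * b * N * delta ^+ 2 / ((N + 1) * delta ^+ 2) ^+ 2.
    by rewrite /b; field; rewrite !gt_eqF.
  rewrite ler_wpM2l//; first by rewrite !mulr_ge0// ?(ltW d2)//; lra.
  rewrite lef_pV2 ?posrE ?exprn_gt0 ?mulr_gt0//.
  by apply: lerXn2r => //; rewrite nnegrE ltW// mulr_gt0.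
have -> : delta ^- n = delta ^- (n - 2) * delta ^- 2.
  by rewrite -invfM -exprD subnK// ltnW.
rewrite /potential -/N -/b expRD /cell_const -/N -/b.
rewrite [leLHS](_ : _ = expR (- b) * (expR (- b * ln (N + 1)) * delta ^- (n - 2)) *
  ((N - 2) * N / (N + 1) ^+ 2 * delta ^- 2)); last by ring.
have q0 : 0 <= (N - 2) * N / (N + 1) ^+ 2 by rewrite divr_ge0 ?sqr_ge0// mulr_ge0; lra.
apply: ler_pM e3.
- by rewrite !mulr_ge0 ?expR_ge0 ?invr_ge0 ?exprn_ge0 ?(ltW d0).
- by rewrite mulr_ge0 ?invr_ge0 ?exprn_ge0 ?(ltW d0).
apply: ler_pM e1 e2; first exact: expR_ge0.
by rewrite mulr_ge0 ?expR_ge0 ?invr_ge0 ?exprn_ge0 ?(ltW d0).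
Qed.

Lemma potential_le (s : R) y (delta T : R) p : (3 <= n)%N -> 0 < delta ->
  `|tdiff s p| <= T ->
  potential s y delta p <= expR ((n%:R - 2) / 2 * T) * Num.sqrt (rho s y delta p) ^- (n - 2).
Proof.
move=> n3 d0 tT; have N3 : 3 <= n%:R :> R by rewrite (ler_nat _ 3).
have r0 := rho_gt0 s y d0 p.
rewrite -natpow_expR_ln ?sqrtr_gt0 ?(ltnW n3)// -expRD ler_expR.
have -> : ln (rho s y delta p) = 2 * ln (Num.sqrt (rho s y delta p)).
  by rewrite -{1}[rho s y delta p]sqr_sqrtr ?(ltW r0)// lnXn ?sqrtr_gt0// mulr_natl.
set l := ln _; set N : R := n%:R in N3 *.
have -> : - ((N - 2) / 2) * (2 * l) = - (N - 2) * l by field.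
rewrite lerD2r; move: tT; rewrite ler_norml => /andP[h _].
have : 0 <= (N - 2) / 2 * (T + tdiff s p) by rewrite mulr_ge0//; lra.
by lra.
Qed.

End potential_bounds.

(** * The grid *)

Section grid_points.
Context (R : realType) (n : nat).
Hypothesis n_ge3 : (3 <= n)%N.
Local Notation point := (R * 'rV[R]_n.-1)%type.
Context (N : nat) (p0 : point) (delta : R).
Local Notation index := {ffun option 'I_n.-1 -> 'I_(N.*2.+1)}.

(** [None] indexes ln t and [Some i] the coordinate x_i. The spacing c is delta for the poles and (1
    - lam) delta for the contracted grid. *)
Definition grid_s (c : R) (q : index) : R := ln p0.1 + c * offset R (q None).
Definition grid_x (c : R) (q : index) : 'rV[R]_n.-1 :=
  \row_i (p0.2 0 i + c * offset R (q (Some i))).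

Lemma tdiff_grid c q : tdiff (grid_s c q) p0 = - (c * offset R (q None)).
Proof. by rewrite /tdiff /grid_s; ring. Qed.

Lemma xdiff_grid c q i : xdiff (grid_x c q) i p0 = - (c * offset R (q (Some i))).
Proof. by rewrite /xdiff /grid_x mxE; ring. Qed.

Definition grid_radius q : R :=
  Num.sqrt (rho (grid_s delta q) (grid_x delta q) delta p0).

Lemma rho_gridE q : rho (grid_s delta q) (grid_x delta q) delta p0 =
  delta ^+ 2 * (1 + offset R (q None) ^+ 2 + \sum_i offset R (q (Some i)) ^+ 2).
Proof.
rewrite /rho tdiff_grid.
have -> : xsqdist (grid_x delta q) p0 = delta ^+ 2 * \sum_i offset R (q (Some i)) ^+ 2.
  by rewrite mulr_sumr; apply: eq_bigr => i _; rewrite xdiff_grid sqrrN exprMn.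
ring.
Qed.

Hypothesis delta_gt0 : 0 < delta.

Lemma grid_radius_gt0 q : 0 < grid_radius q.
Proof. by rewrite sqrtr_gt0; exact: rho_gt0. Qed.

(** From (1 + z)^2 <= 4 (1 + z^2). The summand 1 comes from the delta^2 in [rho] and keeps the pole
    at p0 itself harmless. *)
Lemma grid_radius_ge (q : index) (j : option 'I_n.-1) :
  delta * (1 + `|offset R (q j)|) <= 2 * grid_radius q.
Proof.
have d0 := delta_gt0.
have r0 := grid_radius_gt0 q.
have h : delta ^+ 2 * (1 + offset R (q j) ^+ 2) <= grid_radius q ^+ 2.
  rewrite sqr_sqrtr; last by apply/ltW/rho_gt0.
  rewrite rho_gridE ler_wpM2l ?sqr_ge0// -addrA lerD2l.
  case: j => [i|]; last by rewrite lerDl sumr_ge0// => i _; exact: sqr_ge0.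
  apply: ler_wpDl; first exact: sqr_ge0.
  rewrite (bigD1 i)//= lerDl sumr_ge0// => k _; exact: sqr_ge0.
have z2 : offset R (q j) ^+ 2 = `|offset R (q j)| ^+ 2 by rewrite real_normK ?num_real.
rewrite z2 in h; set z := `|offset R (q j)| in h *.
have z0 : 0 <= z by exact: normr_ge0.
rewrite -(@ler_pXn2r _ 2) ?nnegrE//; last 2 first.
- by rewrite mulr_ge0 ?(ltW d0)//; lra.
- by lra.
have : 0 <= delta ^+ 2 * (1 - z) ^+ 2 by rewrite mulr_ge0 ?sqr_ge0.
have -> : (2 * grid_radius q) ^+ 2 = 4 * grid_radius q ^+ 2 by ring.
set r2 := grid_radius q ^+ 2 in h *; set d2 := delta ^+ 2 in h *.
rewrite exprMn -/d2; have : 0 <= d2 by exact: sqr_ge0.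
nra.
Qed.

Lemma grid_radius_le (q : index) : delta * N%:R >= delta -> 
  grid_radius q <= (n%:R + 1) * (delta * N%:R).
Proof.
move=> T_ge; have d0 := delta_gt0; set T := delta * N%:R in T_ge *.
have T0 : 0 < T by exact: lt_le_trans T_ge.
have n0 : 0 <= n%:R :> R by exact: ler0n.
have N3 : 3 <= n%:R :> R by rewrite (ler_nat _ 3).
have zT (k : 'I_(N.*2.+1)) : delta ^+ 2 * offset R k ^+ 2 <= T ^+ 2.
  rewrite -exprMn -[leLHS]real_normK ?num_real//.
  apply: lerXn2r; rewrite ?nnegrE ?(ltW T0)//.
  by rewrite normrM gtr0_norm// ler_pM2l//; exact: norm_offset_le.
have hs : \sum_i delta ^+ 2 * offset R (q (Some i)) ^+ 2 <= (n%:R - 1) * T ^+ 2.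
  apply: (@le_trans _ _ (\sum_(i < n.-1) T ^+ 2)); first by apply: ler_sum => i _; exact: zT.
  have -> : n%:R - 1 = (n.-1)%:R :> R.
    by rewrite -[in LHS](prednK (ltnW (ltnW n_ge3))) -natr1 addrK.
  by rewrite sumr_const card_ord mulr_natl.
have dT : delta ^+ 2 <= T ^+ 2 by apply: lerXn2r; rewrite ?nnegrE ?(ltW T0) ?(ltW d0).
rewrite -(@ler_pXn2r _ 2) ?nnegrE//; last 2 first.
- exact/ltW/grid_radius_gt0.
- by rewrite mulr_ge0 ?(ltW T0)//; lra.
rewrite sqr_sqrtr; last by apply/ltW/rho_gt0.
rewrite rho_gridE !mulrDr mulr1 mulr_sumr.
have := zT (q None); have T2 : 0 <= T ^+ 2 by exact: sqr_ge0.
set m : R := n%:R in n0 N3 hs *.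
have : 0 <= (m ^+ 2 + m) * T ^+ 2 by apply: mulr_ge0 => //; nra.
have -> : ((m + 1) * T) ^+ 2 = (m ^+ 2 + m) * T ^+ 2 + (m + 1) * T ^+ 2 by ring.
lra.
Qed.

(** Discrete form of the integral of |p|^{1-n} over a cube of half-side delta N, which is of the
    order of that side. One factor 2^{n-1} comes from [grid_radius_ge], the other from counting grid
    points, and 3 from 2 N + 1 <= 3 N. *)
Lemma sum_grid_radius_le : (0 < N)%N ->
  \sum_q delta ^+ n * grid_radius q ^- n.-1 <= 3 * (delta * N%:R) * n%:R * 4 ^+ n.-1.
Proof.
move=> N0; have d0 := delta_gt0.
have nE : n = n.-1.+1 by rewrite (prednK (ltnW (ltnW n_ge3))).
have := @sum_max_norm_pow_le R N (option 'I_n.-1) n.-1 (2 ^+ n.-1)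
  (fun q => delta ^+ n.-1 * grid_radius q ^- n.-1).
rewrite card_option card_ord => /(_ erefl (exprn_ge0 _ (ler0n _ 2)) _)/wrap[|h].
  move=> q j; have r0 := grid_radius_gt0 q.
  rewrite mulrAC -exprMn ler_pdivrMr ?exprn_gt0// -exprMn.
  apply: lerXn2r; rewrite ?nnegrE; last exact: grid_radius_ge.
    by rewrite mulr_ge0 ?(ltW d0)// addr_ge0.
  by rewrite mulr_ge0 ?(ltW r0).
have -> : \sum_q delta ^+ n * grid_radius q ^- n.-1 =
    delta * \sum_q delta ^+ n.-1 * grid_radius q ^- n.-1.
  by rewrite mulr_sumr; apply: eq_bigr => q _; rewrite {1}nE exprS mulrA.
apply: (@le_trans _ _ (delta * ((n.-1.+1)%:R * (N.*2.+1)%:R * 2 ^+ n.-1 * 2 ^+ n.-1))).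
  by rewrite ler_pM2l.
have -> : 4 ^+ n.-1 = 2 ^+ n.-1 * 2 ^+ n.-1 :> R.
  by rewrite -exprMn; congr (_ ^+ _); rewrite -natrM.
rewrite -nE; set P := 2 ^+ n.-1 : R.
have P0 : 0 <= P by rewrite exprn_ge0.
have M3 : (N.*2.+1)%:R <= 3 * N%:R :> R by rewrite -natrM ler_nat; lia.
have -> : delta * (n%:R * (N.*2.+1)%:R * P * P) = (N.*2.+1)%:R * (delta * n%:R * (P * P)) by ring.
have -> : 3 * (delta * N%:R) * n%:R * (P * P) = (3 * N%:R) * (delta * n%:R * (P * P)) by ring.
by rewrite ler_wpM2r// !mulr_ge0// ltW.
Qed.

End grid_points.

(** From e^u >= 1 + u. It turns closeness in ln t, natural for the grid, into the closeness in t of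
    the uniform continuity. *)
Lemma ln_lipschitz (R : realType) (x y : R) : 0 < x <= 1 -> 0 < y <= 1 ->
  `|x - y| <= `|ln x - ln y|.
Proof.
wlog xy : x y / x <= y.
  move=> h hx hy; have [xy|/ltW yx] := leP x y; first exact: h.
  by rewrite distrC (distrC (ln x)); exact: h.
move=> /andP[x0 x1] /andP[y0 y1].
have lxy : ln x <= ln y by rewrite ler_ln ?posrE.
rewrite ler0_norm ?subr_le0// ler0_norm ?subr_le0// !opprB.
have : 1 + (ln x - ln y) <= x / y.
  by apply: le_trans (expR_ge1Dx _) _; rewrite expRD expRN !lnK ?posrE.
rewrite ler_pdivlMr// => h.
have : y * (ln y - ln x) <= 1 * (ln y - ln x) by rewrite ler_wpM2r// subr_ge0.
lra.
Qed.

(** * Cells of the grid and their contractions *)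

Section discretization.
Context (R : realType) (n : nat).
Local Notation point := (R * 'rV[R]_n.-1)%type.

(** In the variables (ln t, x) the cone is convex and contains the open cube of half-side r around
    p0; contracting by 1 - lam towards p0 leaves, around the image of each of its points, a cube of
    half-side lam r inside it. *)
Lemma cone_contraction (X : set 'rV[R]_n.-1) (p0 p z : point) (r lam : R) :
  convex_set (X : set (convex_lmodType 'rV[R]_n.-1)) ->
  (forall y : 'rV_n.-1, (forall i, `|y 0 i - p0.2 0 i| < r) -> X y) -> r <= - ln p0.1 ->
  cone X p -> 0 < lam -> lam <= 1 -> 0 < z.1 ->
  `|ln z.1 - (ln p0.1 + (1 - lam) * (ln p.1 - ln p0.1))| < lam * r ->
  (forall i, `|z.2 0 i - (p0.2 0 i + (1 - lam) * (p.2 0 i - p0.2 0 i))| < lam * r) ->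
  cone X z.
Proof.
move=> cX rX rs [/=]; rewrite in_itv/= => /andP[p1 p2] Xp l0 l1 z0 hs hx; split.
  rewrite /= in_itv/= z0/= ltNge; apply/negP => z1.
  have lnz : 0 <= ln z.1 by exact: ln_ge0.
  have lnp : ln p.1 <= 0 by apply: ln_le0; exact: ltW.
  move: hs; rewrite ltr_norml => /andP[_ h].
  have : 0 <= (1 - lam) * - ln p.1 by rewrite mulr_ge0//; lra.
  have : lam * r <= lam * - ln p0.1 by rewrite ler_pM2l.
  lra.
pose u : 'rV[R]_n.-1 :=
  \row_i (p0.2 0 i + (z.2 0 i - (p0.2 0 i + (1 - lam) * (p.2 0 i - p0.2 0 i))) / lam).
have -> : z.2 = lam *: u + (1 - lam) *: p.2.
  by apply/rowP => i; rewrite !mxE; field; rewrite gt_eqF.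
apply: (convexE cX) => //; last exact: ltW.
apply: rX => i; rewrite mxE addrAC subrr add0r normrM normfV (gtr0_norm l0).
by rewrite ltr_pdivrMr// [r * _]mulrC.
Qed.

Section cells.
Context (N : nat) (p0 : point) (delta : R).
Local Notation index := {ffun option 'I_n.-1 -> 'I_(N.*2.+1)}.

Definition in_cell (q : index) (p : point) : Prop :=
  `|tdiff (grid_s p0 delta q) p| <= delta /\
  forall i, `|xdiff (grid_x p0 delta q) i p| <= delta.

Lemma cylinder_cell (X : set 'rV[R]_n.-1) tau p :
  1 <= tau -> 0 < delta -> tau ^+ 2 = N%:R * delta ->
  cylinder X p0 tau p -> exists q, in_cell q p.
Proof.
move=> tau1 d0 TE [_ _ ht hx].
have xi i : `|xdiff p0.2 i p| <= N%:R * delta.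
  rewrite -TE; have h : xdiff p0.2 i p ^+ 2 <= tau ^+ 2.
    apply: le_trans hx; rewrite /xsqdist (bigD1 i)//= lerDl.
    by apply: sumr_ge0 => j _; exact: sqr_ge0.
  have : `|xdiff p0.2 i p| <= tau.
    rewrite -(@ler_pXn2r _ 2) ?nnegrE//; last by lra.
    by rewrite real_normK ?num_real.
  (* tau <= tau^2 since tau >= 1, so a cube of half-side tau^2 covers the cylinder in the x
     directions too. *)
  by move=> /le_trans; apply; rewrite expr2; nra.
rewrite TE in ht.
have [k0 hk0] := offset_cell d0 ht.
have /choice[k hk] : forall i, exists k : 'I_(N.*2.+1),
    `|xdiff p0.2 i p - delta * offset R k| <= delta.
  by move=> i; exact: (offset_cell d0 (xi i)).
exists [ffun j => if j is Some i then k i else k0]; split.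
  by move: hk0; rewrite /tdiff /grid_s ffunE opprD addrA.
by move=> i; move: (hk i); rewrite /xdiff /grid_x mxE ffunE opprD addrA.
Qed.

(** In each coordinate c |k - k'| <= 2 h < c forces k = k'. The spacing will be at least 3 delta /
    4, against 2 h = delta / 2. *)
Lemma grid_box_inj (c h : R) (q q' : index) (z : point) : 0 < h -> 2 * h < c ->
  log_box (grid_s p0 c q) (grid_x p0 c q) h z ->
  log_box (grid_s p0 c q') (grid_x p0 c q') h z -> q = q'.
Proof.
move=> h0 hc [/=]; rewrite in_itv/= => /andP[a1 a2] a3 [/=].
rewrite in_itv/= => /andP[b1 b2] b3.
have z0 : 0 < z.1 by apply: lt_le_trans a1; exact: expR_gt0.
rewrite expR_le_ln// in a1; rewrite le_expR_ln// in a2.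
rewrite expR_le_ln// in b1; rewrite le_expR_ln// in b2.
have key (k k' : 'I_(N.*2.+1)) (u : R) : `|u - c * offset R k| <= h ->
    `|u - c * offset R k'| <= h -> k = k'.
  move=> hk hk'; apply/val_inj/eqP; apply/negPn/negP => kk'.
  have : c <= c * `|offset R k - offset R k'|.
    rewrite ler_peMr//; first by lra.
    rewrite /offset; have -> : k%:R - N%:R - (k'%:R - N%:R) = k%:R - k'%:R :> R by ring.
    have [lt|lt] : (k < k')%N \/ (k' < k)%N by apply/orP; rewrite -neq_ltn.
      rewrite distrC -natrB ?(ltnW lt)// normr_nat (ler_nat _ 1).
      by rewrite subn_gt0.
    by rewrite -natrB ?(ltnW lt)// normr_nat (ler_nat _ 1) subn_gt0.
  have -> : c * `|offset R k - offset R k'| =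
      `|(u - c * offset R k') - (u - c * offset R k)|.
    rewrite -[in LHS](gtr0_norm (_ : 0 < c)) -?normrM; last lra.
    by congr `|_|; ring.
  have := ler_normB (u - c * offset R k') (u - c * offset R k); lra.
apply/ffunP => -[i|].
  apply: (key _ _ (z.2 0 i - p0.2 0 i)).
    have := a3 i; rewrite /grid_x mxE ler_norml => /andP[c1 c2].
    by apply/andP; split; lra.
  have := b3 i; rewrite /grid_x mxE ler_norml => /andP[c1 c2].
  by apply/andP; split; lra.
apply: (key _ _ (ln z.1 - ln p0.1)).
  by move: a1 a2; rewrite /grid_s ler_norml => ? ?; apply/andP; split; lra.
by move: b1 b2; rewrite /grid_s ler_norml => ? ?; apply/andP; split; lra.
Qed.

(* The box of q is the cell of q contracted towards p0, hence close to all points of the cell. *)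
Lemma box_near_cell (q : index) (lam : R) (p z : point) :
  0 < delta -> 0 <= lam -> lam <= 1 -> in_cell q p ->
  log_box (grid_s p0 ((1 - lam) * delta) q) (grid_x p0 ((1 - lam) * delta) q) (delta / 4) z ->
  [/\ 0 < z.1, `|ln z.1 - (ln p0.1 + (1 - lam) * (ln p.1 - ln p0.1))| < 2 * delta &
   forall i, `|z.2 0 i - (p0.2 0 i + (1 - lam) * (p.2 0 i - p0.2 0 i))| < 2 * delta].
Proof.
move=> d0 l0 l1 [ht hx] [/=]; rewrite in_itv/= => /andP[a1 a2] a3.
have z0 : 0 < z.1 by apply: lt_le_trans a1; exact: expR_gt0.
rewrite expR_le_ln// in a1; rewrite le_expR_ln// in a2.
have key (z' u a o : R) : `|u - (a + delta * o)| <= delta ->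
    a + (1 - lam) * delta * o - delta / 4 <= z' ->
    z' <= a + (1 - lam) * delta * o + delta / 4 ->
    `|z' - (a + (1 - lam) * (u - a))| < 2 * delta.
  move=> h h1 h2; set v := u - (a + delta * o) in h.
  have uE : u = v + a + delta * o by rewrite /v; ring.
  move: h; rewrite ler_norml => /andP[v1 v2].
  have b1 : (1 - lam) * v <= (1 - lam) * delta by rewrite ler_wpM2l//; lra.
  have b2 : (1 - lam) * - delta <= (1 - lam) * v by rewrite ler_wpM2l//; lra.
  have b3 : 0 <= lam * delta by rewrite mulr_ge0// ltW.
  rewrite ltr_norml uE; apply/andP; split; lra.
split => //; first exact: key ht a1 a2.
by move=> i; have := a3 i; rewrite /grid_x mxE => /andP[c1 c2]; apply: key c1 c2;
  have := hx i; rewrite /xdiff /grid_x mxE.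
Qed.

End cells.
End discretization.

(** * The supersolution *)

Lemma exprD_le_double (R : realFieldType) (a b : R) (n : nat) : 0 <= a -> 0 <= b ->
  (a + b) ^+ n <= 2 ^+ n * (a ^+ n + b ^+ n).
Proof.
move=> a0 b0; wlog ab : a b a0 b0 / a <= b.
  move=> h; have [ab|/ltW ba] := leP a b; first exact: h.
  by rewrite addrC (addrC (a ^+ n)); exact: h.
apply: (@le_trans _ _ ((2 * b) ^+ n)).
  by apply: lerXn2r; rewrite ?nnegrE; lra.
by rewrite exprMn ler_wpM2l ?exprn_ge0// lerDr exprn_ge0.
Qed.

Section potential_supersolution.
Context (R : realType) (n : nat).
Hypothesis n_ge3 : (3 <= n)%N.
Local Notation point := (R * 'rV[R]_n.-1)%type.

Section grid_potential.
Context (N : nat) (p0 : point) (delta : R).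
Local Notation index := {ffun option 'I_n.-1 -> 'I_(N.*2.+1)}.
Context (a : index -> R).

(** The weight is a q times the cell volume, normalised so that the pole q alone contributes at most
    - a q to the operator on its cell. *)
Let coef q := (cell_const R n)^-1 * a q * delta ^+ n.
Let pot (q : index) := potential (grid_s p0 delta q) (grid_x p0 delta q) delta.
Let pot_op (q : index) p := pot q p * (((n%:R - 2) / 2) ^+ 2 + 2 * ((n%:R - 2) / 2) * n%:R *
  delta ^+ 2 / rho (grid_s p0 delta q) (grid_x p0 delta q) delta p ^+ 2).

Definition grid_potential (p : point) : R := \sum_q coef q * pot q p.
Definition grid_potential_op (p : point) : R := \sum_q coef q * - pot_op q p.

Lemma operator_on_grid_potential : 0 < delta ->
  operator_on grid_potential grid_potential_op.
Proof.
move=> d0; have n0 : (0 < n)%N by exact: ltnW (ltnW n_ge3).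
apply: operator_on_sum => q; apply: operator_onZ.
exact: operator_on_potential.
Qed.

Lemma Ck_on_grid_potential k : 0 < delta -> Ck_on k (@half_space R n) grid_potential.
Proof.
move=> d0; apply: Ck_on_sum; first exact: open_half_space.
move=> q _; apply: Ck_onM; [exact: open_half_space|exact: Ck_on_cst|].
exact: Ck_on_potential.
Qed.

Hypothesis a_ge0 : forall q, 0 <= a q.

Lemma coef_ge0 q : 0 < delta -> 0 <= coef q.
Proof.
move=> d0; have c0 := cell_const_gt0 R n_ge3.
apply: mulr_ge0; last by rewrite exprn_ge0// ltW.
by apply: mulr_ge0; [rewrite invr_ge0 ltW|exact: a_ge0].
Qed.

Lemma grid_potential_ge0 p : 0 < delta -> 0 <= grid_potential p.
Proof.
move=> d0; apply: sumr_ge0 => q _.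
by apply: mulr_ge0; [exact: coef_ge0|exact: expR_ge0].
Qed.

(** Every summand is nonpositive, so it suffices to keep the one of the pole q, which
    [potential_cell] controls. *)
Lemma grid_potential_op_le q p : 0 < delta -> delta <= 1 -> in_cell p0 delta q p ->
  grid_potential_op p <= - a q.
Proof.
move=> d0 d1 [hs hx]; have c0 := cell_const_gt0 R n_ge3.
have N3 : 3 <= n%:R :> R by rewrite (ler_nat _ 3).
have pot_op0 q' : 0 <= pot_op q' p.
  apply: mulr_ge0; first exact: expR_ge0.
  apply: addr_ge0; first exact: sqr_ge0.
  apply: divr_ge0; last exact: sqr_ge0.
  apply: mulr_ge0; last exact: sqr_ge0.
  by apply: mulr_ge0; lra.
rewrite /grid_potential_op (bigD1 q)//=.
apply: (@le_trans _ _ (coef q * - pot_op q p + 0)).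
  rewrite lerD2l; apply: sumr_le0 => q' _.
  by rewrite mulrN oppr_le0; apply: mulr_ge0; [exact: coef_ge0|exact: pot_op0].
rewrite addr0 mulrN lerN2.
have h := potential_cell n_ge3 d0 d1 hs hx.
apply: le_trans (ler_wpM2l (coef_ge0 q d0) h).
rewrite le_eqVlt; apply/orP; left; apply/eqP.
rewrite /coef; field; by rewrite expf_neq0 ?(lt0r_neq0 d0) ?(lt0r_neq0 c0).
Qed.

Definition center_const (T : R) : R :=
  (cell_const R n)^-1 * expR ((n%:R - 2) / 2 * T).

(** [young_grid] splits each summand: the first parts add up to the discrete n-th power norm,
    bounded by A, the second ones to the sum in [sum_grid_radius_le]. *)
Lemma grid_potential_center_le (N0 T A : R) : 0 < delta -> delta <= T -> T = delta * N%:R ->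
  (0 < N)%N -> 0 < N0 -> \sum_q delta ^+ n * a q ^+ n <= A ->
  grid_potential p0 <= center_const T *
    ((n%:R + 1) * T * (A / N0 ^+ n.-1) + N0 * (3 * T * n%:R * 4 ^+ n.-1)).
Proof.
move=> d0 dT TE N_gt0 N00 hA; have c0 := cell_const_gt0 R n_ge3.
have N0n : 0 < N0 ^+ n.-1 by rewrite exprn_gt0.
have dn : 0 <= delta ^+ n by rewrite exprn_ge0// ltW.
set E := expR ((n%:R - 2) / 2 * T).
have E0 : 0 < E by exact: expR_gt0.
have n0 : 0 <= n%:R :> R by exact: ler0n.
have T0 : 0 < T by exact: lt_le_trans dT.
pose r (q : index) := grid_radius p0 delta q.
pose D := (n%:R + 1) * T.
have step q : coef q * pot q p0 <= center_const T *
    (D / N0 ^+ n.-1 * (delta ^+ n * a q ^+ n) + N0 * (delta ^+ n * r q ^- n.-1)).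
  have h1 : pot q p0 <= E * r q ^- (n - 2).
    apply: potential_le => //; rewrite tdiff_grid normrN normrM gtr0_norm// TE.
    by rewrite ler_pM2l//; exact: norm_offset_le.
  have rD : r q <= D.
    by rewrite /D TE; apply: grid_radius_le => //; rewrite -TE.
  have h2 := young_grid n_ge3 (a_ge0 q) (grid_radius_gt0 p0 d0 q) rD N00.
  apply: (le_trans (ler_wpM2l (coef_ge0 q d0) h1)).
  rewrite /center_const -/E.
  have -> : coef q * (E * r q ^- (n - 2)) =
    (cell_const R n)^-1 * E * delta ^+ n * (a q * r q ^- (n - 2)) by rewrite /coef; ring.
  rewrite [leRHS](_ : _ = (cell_const R n)^-1 * E * delta ^+ n *
    (D * (a q ^+ n / N0 ^+ n.-1) + N0 * r q ^- n.-1)); last by ring.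
  apply: ler_wpM2l h2; apply: mulr_ge0 => //.
  by apply: mulr_ge0; [rewrite invr_ge0 ltW|exact: ltW].
apply: (le_trans (ler_sum _ (fun q _ => step q))).
rewrite -mulr_sumr big_split/= -!mulr_sumr.
apply: ler_wpM2l.
  by apply: mulr_ge0; [rewrite invr_ge0 ltW|exact: ltW].
have D0 : 0 <= D by apply: mulr_ge0; [lra|exact: ltW].
apply: lerD.
  rewrite -/D (_ : D * (A / N0 ^+ n.-1) = D / N0 ^+ n.-1 * A); last by ring.
  by rewrite -mulr_sumr in hA; apply: ler_wpM2l hA; apply: divr_ge0 => //; exact: ltW.
apply: ler_wpM2l; first exact: ltW.
by rewrite TE mulr_sumr; exact: sum_grid_radius_le.
Qed.

End grid_potential.
End potential_supersolution.

Section supersolution.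
Context (R : realType) (n : nat).
Hypothesis n_ge3 : (3 <= n)%N.
Local Notation point := (R * 'rV[R]_n.-1)%type.

Definition uniformly_continuous_on (X : set 'rV[R]_n.-1) (g : point -> R) : Prop :=
  forall a eta : R, 0 < a -> 0 < eta ->
  exists2 theta, 0 < theta & forall p q : point, cone X p -> cone X q ->
    a <= p.1 -> `|p.1 - q.1| < theta -> (forall i, `|p.2 0 i - q.2 0 i| < theta) ->
    `|g p - g q| < eta.

(** The factor 4^n compares the cell volume delta^n with h (2 h)^{n-1} for h = delta / 4; 2^n splits
    (b + 2 eta)^n; the last term collects the error 2 eta over at most (3 N)^n cells. *)
Lemma sum_cells_le (X : set 'rV[R]_n.-1) (g : point -> R) (N : nat) (p0 : point)
    (delta lam eta I : R) (P : pred {ffun option 'I_n.-1 -> 'I_(N.*2.+1)})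
    (a b : {ffun option 'I_n.-1 -> 'I_(N.*2.+1)} -> R) :
  0 < delta -> delta <= 1 -> 0 < lam -> lam <= 1 / 4 -> 0 < eta -> (0 < N)%N ->
  (forall q, P q -> log_box (grid_s p0 ((1 - lam) * delta) q)
     (grid_x p0 ((1 - lam) * delta) q) (delta / 4) `<=` cone X) ->
  (forall q z, P q -> log_box (grid_s p0 ((1 - lam) * delta) q)
     (grid_x p0 ((1 - lam) * delta) q) (delta / 4) z -> b q <= `|g z|) ->
  (forall q, 0 <= b q) -> (forall q, P q -> a q <= b q + 2 * eta) ->
  (forall q, 0 <= a q) -> (forall q, ~~ P q -> a q = 0) ->
  (\int[@lebesgue_point R n]_(p in cone X) (`|g p| ^+ n / p.1)%R%:E = I%:E)%E ->
  \sum_q delta ^+ n * a q ^+ n <=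
    2 ^+ n * (4 ^+ n * I + (6 * eta * (delta * N%:R)) ^+ n).
Proof.
move=> d0 d1 l0 l1 eta0 N0 sub bg b0 ab a0 aP gI.
have n0 : (0 < n)%N by exact: ltnW (ltnW n_ge3).
have nE : n = n.-1.+1 by rewrite prednK.
have dn : 0 <= delta ^+ n by rewrite exprn_ge0// ltW.
have e2 : 0 <= 2 * eta by lra.
have l4 : 0 <= (1 / 4 - lam) * delta by rewrite mulr_ge0// ?(ltW d0)// subr_ge0.
have I_ge : 4 ^- n * \sum_(q | P q) delta ^+ n * b q ^+ n <= I.
  rewrite -lee_fin -gI; apply: (@le_trans _ _
    ((delta / 4 * (2 * (delta / 4)) ^+ n.-1 * \sum_(q | P q) b q ^+ n)%:E)); last first.
    apply: (integral_ge_sum_boxes _ _ sub) => //; try lra.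
      move=> q q' z _ _; apply: grid_box_inj; lra.
  rewrite lee_fin -mulr_sumr [leLHS]mulrA ler_wpM2r//.
    by apply: sumr_ge0 => q _; exact: exprn_ge0.
  rewrite -exprVn -exprMn [in leLHS]nE exprS.
  have -> : 4^-1 * delta = delta / 4 by rewrite mulrC.
  rewrite ler_wpM2l//; first by lra.
  by apply: lerXn2r; rewrite ?nnegrE; lra.
apply: (@le_trans _ _ (\sum_q 2 ^+ n * ((if P q then delta ^+ n * b q ^+ n else 0) +
    delta ^+ n * (2 * eta) ^+ n))).
  apply: ler_sum => q _; case: ifPn => Pq; last first.
    rewrite aP// expr0n gtn_eqF// mulr0 add0r.
    by apply: mulr_ge0; [exact: exprn_ge0|apply: mulr_ge0 => //; exact: exprn_ge0].
  have -> : 2 ^+ n * (delta ^+ n * b q ^+ n + delta ^+ n * (2 * eta) ^+ n) =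
    delta ^+ n * (2 ^+ n * (b q ^+ n + (2 * eta) ^+ n)) by ring.
  rewrite ler_wpM2l//; apply: le_trans (exprD_le_double _ (b0 q) e2).
  by apply: lerXn2r; rewrite ?nnegrE ?a0 ?ab// addr_ge0.
rewrite -mulr_sumr ler_wpM2l ?exprn_ge0// big_split/= -big_mkcond/=; apply: lerD.
  by rewrite mulrC -ler_pdivrMr ?exprn_gt0// mulrC.
rewrite sumr_const card_ffun card_option !card_ord -nE -mulrnAl -mulr_natr natrX.
rewrite -!exprMn; apply: lerXn2r; rewrite ?nnegrE.
- by rewrite !mulr_ge0// ltW.
- by rewrite !mulr_ge0// ltW.
have M3 : (N.*2.+1)%:R <= 3 * N%:R :> R by rewrite -natrM ler_nat; lia.
rewrite (_ : 6 * eta * (delta * N%:R) = delta * (3 * N%:R) * (2 * eta)); last by ring.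
by rewrite ler_wpM2r// ler_pM2l.
Qed.

(** 8^n = 2^n 4^n is the loss in [sum_cells_le], and (n + 1) T bounds [grid_radius]. *)
Definition supersolution_const (T : R) : R :=
  center_const n T * ((n%:R + 1) * T * 8 ^+ n + 3 * T * n%:R * 4 ^+ n.-1).

Lemma supersolution_const_gt0 T : 0 < T -> 0 < supersolution_const T.
Proof.
move=> T0; have c0 := cell_const_gt0 R n_ge3.
have n0 : 0 < n%:R :> R by rewrite ltr0n; exact: ltnW (ltnW n_ge3).
apply: mulr_gt0; first by apply: mulr_gt0; [rewrite invr_gt0|exact: expR_gt0].
apply: addr_gt0; last by rewrite !mulr_gt0 ?exprn_gt0.
by rewrite !mulr_gt0 ?exprn_gt0// addr_gt0.
Qed.

Lemma supersolution_exists (X : set 'rV[R]_n.-1) (g : point -> R) (p0 : point)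
    (tau I eps N0 : R) :
  open X -> convex_set (X : set (convex_lmodType 'rV[R]_n.-1)) ->
  (forall p, 0 <= g p) -> uniformly_continuous_on X g -> cone X p0 -> 1 <= tau ->
  (\int[@lebesgue_point R n]_(p in cone X) (`|g p| ^+ n / p.1)%R%:E = I%:E)%E ->
  0 < eps -> 0 < N0 ->
  exists w Lw : point -> R, [/\ Ck_on 2 (@half_space R n) w, operator_on w Lw,
    forall p, 0 <= w p,
    forall p, cylinder X p0 tau p -> cone X p -> Lw p < - g p &
    w p0 <= supersolution_const (tau ^+ 2) * ((I + eps) / N0 ^+ n.-1 + N0)].
Proof.
move=> oX cX g0 ug cp0 tau1 gI eps0 N00.
set T := tau ^+ 2; have T1 : 1 <= T by rewrite exprn_ege1.
have T0 : 0 < T by exact: lt_le_trans T1.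
have I0 : 0 <= I.
  rewrite -lee_fin -gI; apply: integral_ge0 => p [/=]; rewrite in_itv/= => /andP[p1 _] _.
  by rewrite lee_fin divr_ge0 ?exprn_ge0// ltW.
have [x0X /andP[p01 p02]] : X p0.2 /\ 0 < p0.1 < 1 by case: cp0.
pose s0 := ln p0.1.
have s0_lt0 : s0 < 0 by apply: ln_lt0; rewrite p01 p02.
have [r0 r00 hr0] := open_box oX x0X.
pose r := Num.min r0 (- s0).
have r_gt0 : 0 < r by rewrite lt_min r00 oppr_gt0.
have rs : r <= - s0 by rewrite ge_min lexx orbT.
have hr (y : 'rV_n.-1) : (forall i, `|y 0 i - p0.2 0 i| < r) -> X y.
  by move=> h; apply: hr0 => i; apply: lt_le_trans (h i) _; rewrite ge_min lexx.
(* 6 T is the error factor in [sum_cells_le], so the total error min(1, eps)^n stays below eps. *)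
pose eta := Num.min 1 eps / (6 * T).
have eta0 : 0 < eta.
  by apply: divr_gt0; [rewrite lt_min ltr01 eps0|rewrite mulr_gt0].
have [theta theta0 htheta] := ug (expR (s0 - T)) eta (expR_gt0 _) eta0.
(* Contraction displaces each coordinate by at most lam T <= theta / 2; lam <= 1/4 keeps the
   contracted boxes disjoint. *)
pose lam := Num.min (1 / 4) (theta / (2 * T)).
have lam0 : 0 < lam by rewrite lt_min; apply/andP; split; rewrite divr_gt0// mulr_gt0.
have lam4 : lam <= 1 / 4 by rewrite ge_min lexx.
have lamT : lam * T <= theta / 2.
  apply: (@le_trans _ _ (theta / (2 * T) * T)).
    by rewrite ler_wpM2r ?(ltW T0)// ge_min lexx orbT.
  by rewrite le_eqVlt; apply/orP; left; apply/eqP; field; rewrite gt_eqF.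
(* For delta < kap, 2 delta < lam r puts the boxes into the cone by [cone_contraction], and 2 delta
   < theta / 2 is the rest of the allowed displacement. *)
pose kap := Num.min 1 (Num.min (lam * r / 2) (theta / 4)).
have kap0 : 0 < kap.
  by rewrite !lt_min ltr01/=; apply/andP; split; rewrite divr_gt0// mulr_gt0.
pose N := (Num.truncn (T / kap)).+1.
have NT : T / kap < N%:R.
  have Tk : 0 <= T / kap by rewrite divr_ge0 ?ltW.
  by have /andP[_] := Num.Theory.truncn_itv Tk.
have N_gt0 : 0 < N%:R :> R by rewrite ltr0n.
pose delta := T / N%:R.
have d0 : 0 < delta by rewrite divr_gt0.
have TE : T = delta * N%:R by rewrite /delta divfK// gt_eqF.
have dk : delta < kap by rewrite ltr_pdivrMr// mulrC -ltr_pdivrMr.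
have [d1 [dr dth]] : delta <= 1 /\ (2 * delta < lam * r /\ 4 * delta < theta).
  move: dk; rewrite !lt_min => /and3P[k1 k2 k3].
  by split; [exact: ltW|split; lra].
have N0' : (0 < N)%N by [].
have dT : delta <= T by rewrite [leRHS]TE ler_peMr ?(ltW d0)// (ler_nat _ 1).
pose index := {ffun option 'I_n.-1 -> 'I_(N.*2.+1)}.
pose K := cylinder X p0 tau.
(* Only cells that contain a point of the cone in the cylinder carry weight; [pt] samples such a
   point, with the default p0 for the other cells. *)
pose act (q : index) := `[< exists p, [/\ K p, cone X p & in_cell p0 delta q p] >].
have /choice[pt hpt] : forall q, exists p, act q -> [/\ K p, cone X p & in_cell p0 delta q p].
  move=> q; case: (boolP (act q)) => [/asboolP[p hp]|_]; first by exists p.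
  by exists p0.
(* On active cells a exceeds g at the points of the cone, as the supersolution requires, while b
   stays below g on the contracted box, as the integral bound requires; they differ by at most 2
   eta. *)
pose a q := if act q then g (pt q) + eta else 0.
pose b q := Num.max (g (pt q) - eta) 0.
have a0 q : 0 <= a q by rewrite /a; case: ifP => // _; rewrite addr_ge0// ltW.
pose lam' := 1 - lam.
have boxP q z : act q -> log_box (grid_s p0 (lam' * delta) q)
    (grid_x p0 (lam' * delta) q) (delta / 4) z ->
    [/\ cone X z, `|ln z.1 - ln (pt q).1| < theta &
      forall i, `|z.2 0 i - (pt q).2 0 i| < theta].
  move=> aq bz; have [[_ _ tK xK] cpt cellq] := hpt q aq.
  have lam1 : lam <= 1 by lra.
  have [z0 hs hx] := box_near_cell d0 (ltW lam0) lam1 cellq bz.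
  have far (u w v : R) : `|u - (w + (1 - lam) * (v - w))| < 2 * delta ->
      `|v - w| <= T -> `|u - v| < theta.
    move=> h1 h2; have -> : u - v = (u - (w + (1 - lam) * (v - w))) - lam * (v - w) by ring.
    apply: le_lt_trans (ler_normB _ _) _; rewrite normrM gtr0_norm//.
    have : lam * `|v - w| <= lam * T by rewrite ler_pM2l.
    lra.
  split.
  - apply: (cone_contraction cX hr rs cpt lam0 lam1 z0).
      exact: lt_trans hs dr.
    by move=> i; exact: lt_trans (hx i) dr.
  - exact: far hs tK.
  - move=> i; apply: far (hx i) _.
    have h : ((pt q).2 0 i - p0.2 0 i) ^+ 2 <= T.
      apply: le_trans xK; rewrite /xsqdist (bigD1 i)//= lerDl.
      by apply: sumr_ge0 => j _; exact: sqr_ge0.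
    rewrite -(@ler_pXn2r _ 2) ?nnegrE ?(ltW T0)// real_normK ?num_real//.
    by apply: le_trans h _; rewrite expr2 ler_peMl// ltW.
have ptK q : act q -> expR (s0 - T) <= (pt q).1.
  move=> /hpt[[/andP[p1 _] _ + _] _ _].
  rewrite ler_norml => /andP[h _]; rewrite expR_le_ln//.
  by move: h; rewrite /tdiff -/s0 -/T; lra.
have cone_t (p : point) : cone X p -> 0 < p.1 <= 1.
  by move=> [/=]; rewrite in_itv/= => /andP[-> /ltW ->].
have near_pt q z : act q -> cone X z -> `|ln z.1 - ln (pt q).1| < theta ->
    (forall i, `|z.2 0 i - (pt q).2 0 i| < theta) -> `|g (pt q) - g z| < eta.
  move=> aq cz h1 h2; have [_ cpt _] := hpt q aq.
  apply: htheta => //; first exact: ptK.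
    rewrite distrC; apply: le_lt_trans h1; apply: ln_lipschitz; exact: cone_t.
  by move=> i; rewrite distrC.
exists (grid_potential p0 delta a), (grid_potential_op p0 delta a); split.
- exact: Ck_on_grid_potential.
- exact: operator_on_grid_potential.
- by move=> p; exact: grid_potential_ge0.
- move=> p Kp cp; have TE' : tau ^+ 2 = N%:R * delta by rewrite -/T TE mulrC.
  have [q hq] := cylinder_cell tau1 d0 TE' Kp.
  have aq : act q by apply/asboolP; exists p.
  apply: le_lt_trans (grid_potential_op_le n_ge3 a0 d0 d1 hq) _.
  rewrite ltrN2 /a aq; have [_ _ [h1 h2]] := hpt q aq; have [k1 k2] := hq.
  have tri (u v w : R) : `|u - w| <= delta -> `|v - w| <= delta -> `|u - v| < theta.
    move=> m1 m2; have -> : u - v = (u - w) - (v - w) by ring.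
    by apply: le_lt_trans (ler_normB _ _) _; lra.
  have := near_pt q p aq cp (tri _ _ _ k1 h1) (fun i => tri _ _ _ (k2 i) (h2 i)).
  by rewrite ltr_norml => /andP[? ?]; lra.
have hsum : \sum_q delta ^+ n * a q ^+ n <= 8 ^+ n * (I + eps).
  apply: (@le_trans _ _ (2 ^+ n * (4 ^+ n * I + (6 * eta * (delta * N%:R)) ^+ n))).
    apply: (@sum_cells_le X g N p0 delta lam eta I act a b) => //.
    - by move=> q aq z bz; have [] := boxP q z aq bz.
    - move=> q z aq bz; have [cz h1 h2] := boxP q z aq bz.
      have := near_pt q z aq cz h1 h2; rewrite (ger0_norm (g0 z)) /b ltr_norml => /andP[? ?].
      by rewrite ge_max g0 andbT; lra.
    - by move=> q; rewrite /b le_max lexx orbT.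
    - by move=> q aq; rewrite /a aq; have : g (pt q) - eta <= b q by [rewrite /b le_max lexx]; lra.
    - by move=> q /negbTE aq; rewrite /a aq.
  rewrite -TE; have -> : 6 * eta * T = Num.min 1 eps by rewrite /eta; field; rewrite gt_eqF.
  have min0 : 0 <= Num.min 1 eps by rewrite le_min ler01 ltW.
  have -> : 8 ^+ n = 2 ^+ n * 4 ^+ n :> R by rewrite -exprMn -natrM.
  rewrite -mulrA ler_wpM2l ?exprn_ge0// mulrDr lerD2l.
  apply: (@le_trans _ _ (Num.min 1 eps)).
    by apply: ler_iXnr => //; [exact: ltnW (ltnW n_ge3)|rewrite ge_min lexx].
  apply: (@le_trans _ _ eps); first by rewrite ge_min lexx orbT.
  by rewrite ler_peMl ?(ltW eps0)// exprn_ege1// (ler_nat _ 1).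
have := grid_potential_center_le n_ge3 p0 a0 d0 dT TE N0' N00 hsum.
move=> /le_trans; apply; rewrite /supersolution_const -[leRHS]mulrA.
have n0 : 0 <= n%:R :> R by exact: ler0n.
have cc0 : 0 <= center_const n T.
  have c0 := cell_const_gt0 R n_ge3.
  by apply: mulr_ge0; [rewrite invr_ge0 ltW|exact: expR_ge0].
rewrite ler_wpM2l//; set A1 := (n%:R + 1) * T; set A2 := 3 * T * n%:R * 4 ^+ n.-1.
rewrite [leRHS]mulrDl.
have A10 : 0 <= A1 * 8 ^+ n.
  by apply: mulr_ge0; [apply: mulr_ge0; [lra|exact: ltW]|exact: exprn_ge0].
have A20 : 0 <= A2.
  apply: mulr_ge0; last exact: exprn_ge0.
  by apply: mulr_ge0 => //; apply: mulr_ge0 => //; exact: ltW.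
have Q0 : 0 <= (I + eps) / N0 ^+ n.-1.
  by apply: divr_ge0; [lra|rewrite exprn_ge0// ltW].
have -> : A1 * (8 ^+ n * (I + eps) / N0 ^+ n.-1) = A1 * 8 ^+ n * ((I + eps) / N0 ^+ n.-1).
  by ring.
apply: lerD; first by rewrite ler_wpM2l// lerDl ltW.
by rewrite mulrC ler_wpM2l// lerDr.
Qed.

End supersolution.

(** * The estimate *)

Section estimate.
Context (R : realType) (n : nat).
Hypothesis n_ge3 : (3 <= n)%N.
Local Notation point := (R * 'rV[R]_n.-1)%type.
Implicit Types (X : set 'rV[R]_n.-1) (f g v : point -> R).

Lemma negpart_le_dist (x y : R) :
  `|Num.max (- x) 0 - Num.max (- y) 0| <= `|x - y|.
Proof.
rewrite ler_norml; have := ler_norm (x - y); have := ler_norm (y - x).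
rewrite (distrC y) => h1 h2.
have [a|a] := leP (- x) 0; have [b|b] := leP (- y) 0; apply/andP; split; lra.
Qed.

Lemma uniformly_continuous_negpart X f : bounded_set X ->
  continuous_up_to (cone X) (cone_closure X) (fun p => p.1 ^+ 2 * f p) ->
  uniformly_continuous_on X (fun p => p.1 ^+ 2 * Num.max (- f p) 0).
Proof.
move=> bX [g' [cg' gE]] a eta a0 eta0.
have [theta theta0 h] := within_unif_continuous bX cg' a0 eta0.
exists theta => // p q cp cq ap pq1 pq2; apply: le_lt_trans (h p q cp cq ap pq1 pq2).
have E r : cone X r -> r.1 ^+ 2 * Num.max (- f r) 0 = Num.max (- g' r) 0.
  by move=> cr; rewrite maxr_pMr ?sqr_ge0// mulr0 mulrN gE.
by rewrite !E//; exact: negpart_le_dist.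
Qed.

Lemma sup_pos_ge (A : set point) v p : A p -> ((Num.max (v p) 0)%:E <= sup_pos A v)%E.
Proof. by move=> Ap; apply: ereal_sup_ubound; exists p. Qed.

Lemma interior_estimate X (h : R -> R) f v (S M I L d0 : R) (p0 : point) :
  open X -> bounded_set X -> convex_set (X : set (convex_lmodType 'rV[R]_n.-1)) ->
  0 < d0 -> (forall p, cone X p -> cone_boundary_dist X p <= d0) ->
  usc_on (cone_closure X) v -> viscosity_subsolution X h f v ->
  (forall a b, a <= b -> h b <= h a) -> h 0 = 0 ->
  continuous_up_to (cone X) (cone_closure X) (fun p => p.1 ^+ 2 * f p) ->
  0 <= S -> S <= M ->
  (forall p, cone X p -> v p <= M) -> (forall p, cone_boundary X p -> v p <= S) ->
  (\int[@lebesgue_point R n]_(p in cone X)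
     (`|p.1 ^+ 2 * Num.max (- f p) 0| ^+ n / p.1)%R%:E = I%:E)%E ->
  0 <= L -> L ^+ n = I -> cone X p0 ->
  v p0 <= S + (M - S) / 2 + 2 * supersolution_const n (barrier_radius n d0 ^+ 2) * L.
Proof.
move=> oX bX cX d0_gt0 hd usc sub hdec h0 cf S0 SM vM vS gI L0 LI cp0.
have [tau1 _] := barrier_radius_ge n d0_gt0.
set tau := barrier_radius n d0 in tau1 *.
have C0 : 0 < supersolution_const n (tau ^+ 2) by apply: supersolution_const_gt0 => //; nra.
set C := supersolution_const n (tau ^+ 2) in C0 *.
apply/ler_addgt0Pr => e e0.
(* The bound on w p0 becomes 2 C (L + e'), and 2 C e' = e. The shift keeps N0 = L + e' positive even
   for L = 0; with eps = e'^n one has (L^n + e'^n) / N0^{n-1} <= N0. *)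
pose e' := e / (2 * C).
have e'0 : 0 < e' by rewrite divr_gt0// mulr_gt0.
have N00 : 0 < L + e' by rewrite ltr_wpDl.
have g0 p : 0 <= p.1 ^+ 2 * Num.max (- f p) 0.
  by rewrite mulr_ge0 ?sqr_ge0// le_max lexx orbT.
have [w [Lw [Cw ow w0 Lwf wp0]]] := supersolution_exists n_ge3 oX cX g0
  (uniformly_continuous_negpart bX cf) cp0 tau1 gI (exprn_gt0 n e'0) N00.
have Lwf' p : cylinder X p0 tau p -> cone X p -> Lw p < p.1 ^+ 2 * f p.
  move=> Kp cp; apply: lt_le_trans (Lwf p Kp cp) _.
  by rewrite -mulrN ler_wpM2l ?sqr_ge0// lerNl le_max lexx.
have := supersolution_estimate n_ge3 oX bX cX d0_gt0 hd usc sub hdec h0 S0 SM vM vS cp0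
  Cw ow (fun p _ => w0 p) Lwf'.
move: wp0; rewrite -/C.
have q : (I + e' ^+ n) / (L + e') ^+ n.-1 <= L + e'.
  rewrite ler_pdivrMr ?exprn_gt0// -exprS prednK ?(ltnW (ltnW n_ge3))// -LI.
  have nn : (0 < n)%N by exact: ltnW (ltnW n_ge3).
  case: (n) nn => // k _; elim: k => [|k ih]; first by rewrite !expr1.
  rewrite 3!(exprS _ k.+1).
  have h1 : 0 <= L ^+ k.+1 by exact: exprn_ge0.
  have h2 : 0 <= e' ^+ k.+1 by apply: exprn_ge0; exact: ltW.
  have h3 : (L + e') * (L ^+ k.+1 + e' ^+ k.+1) <= (L + e') * (L + e') ^+ k.+1.
    by rewrite ler_wpM2l// ltW.
  have h4 : 0 <= L * e' ^+ k.+1 by exact: mulr_ge0.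
  have h5 : 0 <= e' * L ^+ k.+1 by apply: mulr_ge0 => //; exact: ltW.
  lra.
move=> wp0 vle.
have : C * ((I + e' ^+ n) / (L + e') ^+ n.-1 + (L + e')) <= C * (2 * (L + e')).
  by rewrite ler_pM2l//; lra.
have : C * (2 * e') = e by rewrite /e'; field; rewrite gt_eqF.
lra.
Qed.

End estimate.

Theorem theorem1p1 (R : realType) (n : nat) (n_ge3 : (3 <= n)%N)
    (K0 sigma d0 : R) (K0_ge1 : 1 <= K0) (sigma_gt0 : 0 < sigma)
    (sigma_lt1 : sigma < 1) (d0_gt0 : 0 < d0) :
  exists C : R, 0 < C /\
    forall (X : set 'rV[R]_n.-1) (h : R -> R)
           (f v : R * 'rV[R]_n.-1 -> R),
    bounded_convex_smooth_domain X ->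
    condition_G X K0 sigma d0 ->
    continuous h -> (forall a b, a <= b -> h b <= h a) -> h 0 = 0 ->
    (forall p, cone X p -> {for p, continuous f}) ->
    usc_on (cone_closure X) v ->
    viscosity_subsolution X h f v ->
    (sup_pos (cone X) v < +oo)%E ->
    continuous_up_to (cone X) (cone_closure X) (fun p => p.1 ^+ 2 * f p) ->
    (cone_Lnorm X (fun p => p.1 ^+ 2 * f p)%R < +oo)%E ->
    (sup_pos (cone X) v <=
       sup_pos (cone_boundary X) v +
       (C * K0 * d0)%R%:E *
         cone_Lnorm X (fun p => p.1 ^+ 2 * Num.max (- f p) 0)%R)%E.
Proof.
pose C1 := supersolution_const n (barrier_radius n d0 ^+ 2).
have C10 : 0 < C1.
  have [t1 _] := barrier_radius_ge n d0_gt0.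
  by apply: supersolution_const_gt0 => //; rewrite exprn_gt0//; lra.
(* M <= S + (M - S) / 2 + 2 C1 L gives M - S <= 4 C1 L; the division compensates the factor d0 of
   the statement, and K0 >= 1 only enlarges the bound. *)
pose C := 4 * C1 / d0; exists C; split; first by rewrite divr_gt0// mulr_gt0.
move=> X h f v [oX bX cX _] hG _ hdec h0 _ usc sub supM cf _.
(* For an empty cone the left-hand side is the supremum of the empty set, -oo. *)
have [E|/set0P[p1 cp1]] := eqVneq (cone X) set0.
  by rewrite /sup_pos E image_set0 ereal_sup0 leNye.
have M0 : (0 <= sup_pos (cone X) v)%E.
  by apply: le_trans (sup_pos_ge v cp1); rewrite lee_fin le_max lexx orbT.
(* A point of the face t = 1 shows that the boundary supremum is not -oo. *)
have bp1 : cone_boundary X (1, p1.2) by left; split => //; case: cp1.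
have S0 : (0 <= sup_pos (cone_boundary X) v)%E.
  by apply: le_trans (sup_pos_ge v bp1); rewrite lee_fin le_max lexx orbT.
have CK0 : 0 < C * K0 * d0.
  apply: mulr_gt0 => //; apply: mulr_gt0; last by lra.
  by apply: divr_gt0 => //; exact: mulr_gt0.
pose J := (\int[@lebesgue_point R n]_(p in cone X)
  (`|p.1 ^+ 2 * Num.max (- f p) 0| ^+ n / p.1)%R%:E)%E.
have J0 : (0 <= J)%E.
  apply: integral_ge0 => p [/=]; rewrite in_itv/= => /andP[p0 _] _.
  by rewrite lee_fin divr_ge0 ?exprn_ge0// ltW.
rewrite /cone_Lnorm -/J.
have pow0 : (0 <= J `^ n%:R^-1)%E by exact: poweR_ge0.
case SE : (sup_pos (cone_boundary X) v) S0 => [S| |] // S0; last first.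
  by rewrite addye ?leey// gt_eqF// (lt_le_trans ltNy0)// mule_ge0// lee_fin ltW.
case ME : (sup_pos (cone X) v) M0 supM => [M| |] // M0 _.
have n0 : n%:R != 0 :> R by rewrite pnatr_eq0 -lt0n; exact: ltnW (ltnW n_ge3).
case JE : J J0 => [I| |] // J0; last first.
  by rewrite poweRyr ?invr_eq0// gt0_muley ?lte_fin// addey ?leey.
rewrite poweR_EFin -EFinM -EFinD lee_fin; rewrite !lee_fin in S0 M0 J0.
set L := I `^ n%:R^-1.
have L0 : 0 <= L by exact: powR_ge0.
have LI : L ^+ n = I by rewrite -powR_mulrn// -powRrM mulVf// powRr1.
have CL : 4 * C1 * L <= C * K0 * d0 * L.
  have -> : C * K0 * d0 = 4 * C1 * K0 by rewrite /C; field; rewrite gt_eqF.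
  by rewrite ler_wpM2r// ler_peMr// mulr_ge0// ltW.
have [MS|/ltW SM] := leP M S; first by apply: ler_wpDr => //; rewrite mulr_ge0// ltW.
have vM p : cone X p -> v p <= M.
  by move=> cp; have := sup_pos_ge v cp; rewrite ME lee_fin ge_max => /andP[].
have vS p : cone_boundary X p -> v p <= S.
  by move=> bp; have := sup_pos_ge v bp; rewrite SE lee_fin ge_max => /andP[].
have hd p : cone X p -> cone_boundary_dist X p <= d0 by move=> /hG[].
have est p : cone X p -> v p <= S + (M - S) / 2 + 2 * C1 * L.
  by apply: interior_estimate usc sub hdec h0 cf S0 SM vM vS JE L0 LI.
have : M <= S + (M - S) / 2 + 2 * C1 * L.
  rewrite -lee_fin -ME; apply: ge_ereal_sup => _ [p cp <-].
  rewrite lee_fin ge_max est//=.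
  have : 0 <= C1 * L by rewrite mulr_ge0// ltW.
  lra.
lra.
Qed.
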